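(* Let $B$ be a Banach space, let $1 \le p < \infty$, and let $\mathcal{F} \subset L^p(\mathbb{R}^d;B)$ be a subset. Then $\mathcal{F}$ is totally bounded in $L^p(\mathbb{R}^d;B)$ if and only if it is $L^p$-equivanishing, $L^p$-equicontinuous, and totally bounded in the mean.
   Context: $\mathbb{R}^d$ carries Lebesgue measure. A function $f\colon \mathbb{R}^d \to B$ is Bochner measurable if it is the almost everywhere limit of a sequence of simple functions (functions taking finitely many values, each on a measurable set of finite measure). $L^p(\mathbb{R}^d;B)$ is the Bochner space of (classes of) Bochner measurable functions with $\|f\|_p = \left(\int_{\mathbb{R}^d}\|f(x)\|^p\,dx\right)^{1/p}<\infty$. Integrals of $B$-valued functions are Bochner integrals. A subset $S$ of a metric space is totally bounded if for every $\varepsilon>0$ it can be covered by finitely many sets of diameter less than $\varepsilon$. For $\mathcal{F}\subset L^p(\mathbb{R}^d;B)$: - $\mathcal{F}$ is $L^p$-equivanishing if $\int_{\{|x|>r\}}\|f(x)\|^p\,dx\to 0$ as $r\to\infty$, uniformly for $f\in\mathcal{F}$. - $\mathcal{F}$ is $L^p$-equicontinuous if $\|\sigma_h f-f\|_p\to 0$ as $|h|\to 0$, uniformly for $f\in\mathcal{F}$, where $(\sigma_h f)(x)=f(x+h)$ for $x,h\in\mathbb{R}^d$. - $\mathcal{F}$ is totally bounded in the mean if for each bounded measurable set $E\subset\mathbb{R}^d$ the set $\left\{\int_E f(x)\,dx : f\in\mathcal{F}\right\}$ is totally bounded in $B$. *)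

(* Defs.v *)
From HB Require Import structures.
From mathcomp Require Import all_boot all_order all_algebra.
From mathcomp Require Import all_classical all_reals all_analysis.
Set Implicit Arguments.
Unset Strict Implicit.
Unset Printing Implicit Defensive.
Import Order.TTheory GRing.Theory Num.Theory.
Import numFieldNormedType.Exports.
Local Open Scope classical_set_scope.
Local Open Scope ring_scope.

(* The library provides Lebesgue measure on R only.  On R^d we take the product
   sigma-algebra, the iterated product of [lebesgue_measure], and then its
   Caratheodory completion, so that [measurable] on [Rn R d] means Lebesgue
   measurable.  [lebesgueRn_box] confirms the normalization. *)

Definition borelRn (R : realType) (d : nat) := 'rV[R]_d.

Definition borelRn_display : measure_display.
Proof. exact: (measure_tuple_display default_measure_display). Qed.

Section borelRn_measurable.
Variables (R : realType) (d : nat).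

HB.instance Definition _ := Pointed.on (borelRn R d).

Definition coordRn (i : 'I_d) (x : borelRn R d) : measurableTypeR R := x ord0 i.

Let borel0 : g_sigma_preimage coordRn set0.
Proof. exact: sigma_algebra0. Qed.

Let borelC A : g_sigma_preimage coordRn A -> g_sigma_preimage coordRn (~` A).
Proof. exact: sigma_algebraC. Qed.

Let borel_bigcup (F : (set (borelRn R d))^nat) :
  (forall i, g_sigma_preimage coordRn (F i)) ->
  g_sigma_preimage coordRn (\bigcup_i F i).
Proof. exact: sigma_algebra_bigcup. Qed.

HB.instance Definition _ := @isMeasurable.Build borelRn_display
  (borelRn R d) (g_sigma_preimage coordRn) borel0 borelC borel_bigcup.

Lemma measurable_coordRn (i : 'I_d) : measurable_fun setT (coordRn i).
Proof.
move=> _ Y mY; rewrite setTI; apply: sub_sigma_algebra => /=.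
rewrite -bigcup_seq/=; exists i => /=; first by rewrite mem_index_enum.
by exists Y => //; rewrite setTI.
Qed.

Lemma measurable_funRnP d1 (T : measurableType d1) (f : T -> borelRn R d) :
  (forall i, measurable_fun setT (coordRn i \o f)) -> measurable_fun setT f.
Proof.
move=> mf _ A mA; rewrite setTI.
suff : measurable `<=` [set B | d1.-measurable (f @^-1` B)] by apply.
apply: smallest_sub.
- split=> [|B mB|F mF] /=.
  + by rewrite preimage_set0.
  + by rewrite setTD preimage_setC; exact: (@measurableC _ _ _ mB).
  + by rewrite preimage_bigcup; apply: bigcup_measurable => k _; exact: mF.
- rewrite -bigcup_seq => _ [i _] [B mB <-] /=.
  by have := mf i measurableT B mB; rewrite !setTI.
Qed.

End borelRn_measurable.

Section iterated_product.
Variable R : realType.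

Definition consRn (d : nat) (x : measurableTypeR R * borelRn R d) :
    borelRn R d.+1 :=
  \row_i oapp (x.2 ord0) x.1 (unlift ord0 i).

Definition unconsRn (d : nat) (x : borelRn R d.+1) :
    measurableTypeR R * borelRn R d :=
  (x ord0 ord0, \row_i x ord0 (lift ord0 i)).

Lemma consRnK d : cancel (@consRn d) (@unconsRn d).
Proof.
move=> [a x]; rewrite /unconsRn mxE unlift_none; congr pair.
by apply/rowP => i; rewrite !mxE liftK.
Qed.

Lemma unconsRnK d : cancel (@unconsRn d) (@consRn d).
Proof.
by move=> x; apply/rowP => i; rewrite mxE; case: unliftP => [j ->|->] /=; rewrite ?mxE.
Qed.

Lemma measurable_consRn d : measurable_fun setT (@consRn d).
Proof.
apply: measurable_funRnP => i.
case: (unliftP ord0 i) => [j ->|->].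
- rewrite (_ : _ \o _ = coordRn j \o snd).
    by apply: measurableT_comp; [exact: measurable_coordRn|].
  by apply/funext => x; rewrite /= /coordRn mxE liftK.
- rewrite (_ : _ \o _ = fst); first exact: measurable_fst.
  by apply/funext => x; rewrite /= /coordRn mxE unlift_none.
Qed.

Lemma measurable_unconsRn d : measurable_fun setT (@unconsRn d).
Proof.
apply/measurable_fun_pair; first exact: measurable_coordRn.
apply: measurable_funRnP => i.
rewrite (_ : _ \o _ = coordRn (lift ord0 i)); first exact: measurable_coordRn.
by apply/funext => x; rewrite /= /coordRn mxE.
Qed.

Section step.
Variables (d : nat).
Variable l : {sigma_finite_measure set (measurableTypeR R) -> \bar R}.
Variable m : {sigma_finite_measure set (borelRn R d) -> \bar R}.

Definition product_step : set (borelRn R d.+1) -> \bar R :=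
  pushforward (l \x m)%E (@consRn d).

Let product_step0 : product_step set0 = 0%E.
Proof. by rewrite /product_step /pushforward preimage_set0 measure0. Qed.

Let product_step_ge0 A : (0 <= product_step A)%E.
Proof. by rewrite /product_step /pushforward. Qed.

Let product_step_sigma_additive : semi_sigma_additive product_step.
Proof.
pose mf := @measurable_consRn d.
move=> F mF tF mUF; rewrite /product_step /pushforward preimage_bigcup.
apply: measure_semi_sigma_additive.
- by move=> n; rewrite -[X in measurable X]setTI; exact: mf.
- apply/trivIsetP => /= i j _ _ ij; rewrite -preimage_setI.
  by move/trivIsetP : tF => /(_ _ _ _ _ ij) ->//; rewrite preimage_set0.
- by rewrite -preimage_bigcup -[X in measurable X]setTI; exact: mf.
Qed.

HB.instance Definition _ := isMeasure.Build _ _ _ product_step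
  product_step0 product_step_ge0 product_step_sigma_additive.

Let product_step_sigma_finite : sigma_finite setT product_step.
Proof.
have /sigma_finiteP[F [TF ndF Foo]] := sigma_finiteT l.
have /sigma_finiteP[G [TG ndG Goo]] := sigma_finiteT m.
exists (fun n => @unconsRn d @^-1` (F n `*` G n)).
  apply/esym; rewrite -subTset => x _.
  have [k _ Fk] : (\bigcup_i F i) (unconsRn x).1 by rewrite -TF.
  have [k' _ Gk'] : (\bigcup_i G i) (unconsRn x).2 by rewrite -TG.
  exists (maxn k k') => //; split.
  - by move: Fk; exact/subsetPset/ndF/leq_maxl.
  - by move: Gk'; exact/subsetPset/ndG/leq_maxr.
move=> n; have [mF Fnoo] := Foo n; have [mG Gnoo] := Goo n; split.
  rewrite -[X in measurable X]setTI.
  by apply: measurable_unconsRn => //; exact: measurableX.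
rewrite /product_step /pushforward -comp_preimage.
rewrite (_ : _ \o _ = id) ?preimage_id; last by apply/funext => x; exact: consRnK.
by rewrite product_measure1E// lte_mul_pinfty// ge0_fin_numE.
Qed.

HB.instance Definition _ := Measure_isSigmaFinite.Build _ _ _ product_step
  product_step_sigma_finite.

End step.

Fixpoint borel_lebesgue (d : nat) :
    {sigma_finite_measure set (borelRn R d) -> \bar R} :=
  match d with
  | 0 => dirac ((0 : 'rV[R]_0) : borelRn R 0)
  | d'.+1 => product_step lebesgue_measure (borel_lebesgue d')
  end.

Lemma measurable_box (d : nat) (a b : 'rV[R]_d) :
  measurable [set x : borelRn R d | forall i, x ord0 i \in `[a ord0 i, b ord0 i]].
Proof.
rewrite [X in measurable X](_ : _ =
    \bigcap_(i in [set: 'I_d]) (coordRn i @^-1` `[a ord0 i, b ord0 i]%classic)).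
  apply: fin_bigcap_measurable => // i _; rewrite -[X in measurable X]setTI.
  by apply: measurable_coordRn => //; exact: measurable_itv.
by apply/seteqP; split => x /= H i; [move=> _|]; exact: H.
Qed.

Lemma borel_lebesgue_box (d : nat) (a b : 'rV[R]_d) :
  (forall i, a ord0 i <= b ord0 i) ->
  borel_lebesgue d [set x : borelRn R d |
    forall i, x ord0 i \in `[a ord0 i, b ord0 i]] =
  (\prod_(i < d) (b ord0 i - a ord0 i))%:E.
Proof.
elim: d => [|d IH] in a b * => ab.
  rewrite big_ord0 /= /dirac indicE.
  by rewrite mem_set//= => -[].
rewrite big_ord_recl /= /product_step /pushforward.
pose a' : 'rV[R]_d := \row_i a ord0 (lift ord0 i).
pose b' : 'rV[R]_d := \row_i b ord0 (lift ord0 i).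
pose A : set (measurableTypeR R) := `[a ord0 ord0, b ord0 ord0]%classic.
pose B : set (borelRn R d) :=
  [set x | forall i, x ord0 i \in `[a' ord0 i, b' ord0 i]].
transitivity ((@lebesgue_measure R \x borel_lebesgue d)%E (A `*` B)).
  congr (product_measure1 _ _ _).
  apply/seteqP; split => [[u x] /= H|[u x] /= [H1 H2] i].
  - split=> [|i]; first by have := H ord0; rewrite mxE unlift_none.
    by have := H (lift ord0 i); rewrite !mxE liftK.
  - rewrite mxE; case: (unliftP ord0 i) => [j ->|->] //=.
    by have := H2 j; rewrite !mxE.
have mA : measurable A by exact: measurable_itv.
rewrite product_measure1E//; last exact: measurable_box.
rewrite EFinM; congr (_ * _)%E.
  rewrite [LHS](_ : _ = lebesgue_measure A)// lebesgue_measure_itv /= lte_fin.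
  case: ltP => // h; congr EFin; apply/eqP.
  by rewrite eq_sym subr_eq0 eq_le h ab.
rewrite {}/B IH; last by move=> i; rewrite !mxE.
by congr EFin; apply: eq_bigr => i _; rewrite !mxE.
Qed.

End iterated_product.

Definition Rn (R : realType) (d : nat) := 'rV[R]_d.

HB.instance Definition _ (R : realType) (d : nat) := GRing.Zmodule.on (Rn R d).

HB.instance Definition _ (R : realType) (d : nat) :=
  Measurable.copy (Rn R d) (caratheodory_type (borel_lebesgue R d)^*%mu).

Definition lebesgueRn (R : realType) (d : nat) : set (Rn R d) -> \bar R :=
  @completed_measure_extension _ _ _ (borel_lebesgue R d).

HB.instance Definition _ (R : realType) (d : nat) := Measure.on (@lebesgueRn R d).

Lemma lebesgueRn_box (R : realType) (d : nat) (a b : 'rV[R]_d) :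
  (forall i, a ord0 i <= b ord0 i) ->
  lebesgueRn [set x : Rn R d | forall i, x ord0 i \in `[a ord0 i, b ord0 i]] =
  (\prod_(i < d) (b ord0 i - a ord0 i))%:E.
Proof.
move=> ab; rewrite -(borel_lebesgue_box ab).
exact: (measurable_mu_extE (borel_lebesgue R d) (measurable_box a b)).
Qed.

(* The norm of 'rV[R]_d is the maximum norm; |x| is the Euclidean one. *)
Definition enorm (R : realType) (d : nat) (x : Rn R d) : R :=
  Num.sqrt (\sum_(i < d) (x ord0 i) ^+ 2).

Section totally_bounded.
Variables (R : realType) (T : Type) (dist : T -> T -> \bar R).

(* The diameter of the empty set is -oo, which is harmless in a cover. *)
Definition diameter (U : set T) : \bar R :=
  ereal_sup [set dist u.1 u.2 | u in U `*` U].

Definition totally_bounded (S : set T) : Prop :=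
  forall e : R, 0 < e ->
    exists C : set (set T), [/\ finite_set C,
      (forall U, C U -> (diameter U < e%:E)%E) &
      S `<=` \bigcup_(U in C) U].

End totally_bounded.

Section bochner.
Context d (T : measurableType d) (R : realType).
Variables (mu : {measure set T -> \bar R}) (B : completeNormedModType R).

(* The value 0 is exempted from the finite measure condition, since the
   fibres of s cover the whole space. *)
Definition bochner_simple (s : T -> B) : Prop :=
  [/\ finite_set (range s),
      (forall b, measurable (s @^-1` [set b])) &
      (forall b, b != 0 -> (mu (s @^-1` [set b]) < +oo)%E)].

Definition bochner_measurable (f : T -> B) : Prop :=
  exists s : nat -> T -> B, (forall n, bochner_simple (s n)) /\
    {ae mu, forall x, s n x @[n --> \oo] --> f x}.

(* [fine] only matters at b = 0, where the term vanishes anyway. *)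
Definition simple_integral (s : T -> B) : B :=
  \sum_(b \in range s) fine (mu (s @^-1` [set b])) *: b.

Definition is_bochner_integral (f : T -> B) (y : B) : Prop :=
  bochner_measurable f /\
  exists s : nat -> T -> B, [/\ forall n, bochner_simple (s n),
    (\int[mu]_x (`|f x - s n x|)%:E)%E @[n --> \oo] --> 0%E &
    simple_integral (s n) @[n --> \oo] --> y].

(* Total: 0 when f is not Bochner integrable on E. *)
Definition bochner_integral (E : set T) (f : T -> B) : B :=
  xget 0 [set y | is_bochner_integral (patch (fun=> 0) E f) y].

Definition bochner_Lnorm (p : R) (f : T -> B) : \bar R :=
  Lnorm mu p%:E (fun x => (`|f x|)%:E).

Record LpFun (p : R) := {
  LpFun_val :> T -> B ;
  LpFun_measurable : bochner_measurable LpFun_val ;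
  LpFun_finite : (bochner_Lnorm p LpFun_val < +oo)%E
}.

HB.instance Definition _ p := gen_eqMixin (LpFun p).
HB.instance Definition _ p := gen_choiceMixin (LpFun p).

Section quotient.
Variable p : R.

Definition Lp_eq (f g : LpFun p) : bool := `[< {ae mu, forall x, f x = g x} >].

Lemma Lp_eq_refl : reflexive Lp_eq.
Proof. by move=> f; apply/asboolP; exact: aeW. Qed.

Lemma Lp_eq_sym : symmetric Lp_eq.
Proof.
by move=> f g; apply/idP/idP => /asboolP h; apply/asboolP; apply: filterS h.
Qed.

Lemma Lp_eq_trans : transitive Lp_eq.
Proof.
move=> g f h /asboolP fg /asboolP gh; apply/asboolP.
by apply: filterS2 fg gh => x -> ->.
Qed.

Canonical Lp_eq_equiv := EquivRel Lp_eq Lp_eq_refl Lp_eq_sym Lp_eq_trans.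

Definition Lp : Type := {eq_quot Lp_eq}%qT.
HB.instance Definition _ := Choice.on Lp.
HB.instance Definition _ := EqQuotient.on Lp.

(* A class acts as a function through an arbitrary representative: everything
   below is invariant under almost everywhere equality. *)
Definition Lp_fun (f : Lp) : T -> B := LpFun_val (repr f).

Definition Lp_dist (f g : Lp) : \bar R :=
  bochner_Lnorm p (fun x => Lp_fun f x - Lp_fun g x).

End quotient.

End bochner.
Coercion Lp_fun : Lp >-> Funclass.

Section kolmogorov_riesz.
Context (R : realType) (d : nat) (B : completeNormedModType R) (p : R).
Local Notation leb := (@lebesgueRn R d).
Implicit Type F : set (Lp leb B p).

Definition Lp_equivanishing F : Prop :=
  forall e : R, 0 < e -> \forall r \near +oo, forall f, F f ->
    (\int[leb]_(x in [set x | (r < enorm x)%R]) (`|f x| `^ p)%:E < e%:E)%E.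

Definition translate (h : Rn R d) (f : Rn R d -> B) : Rn R d -> B :=
  fun x => f (x + h).

Definition Lp_equicontinuous F : Prop :=
  forall e : R, 0 < e -> exists2 delta : R, 0 < delta &
    forall h, enorm h < delta -> forall f, F f ->
      (bochner_Lnorm leb p (fun x => translate h f x - f x)%R < e%:E)%E.

Definition totally_bounded_in_mean F : Prop :=
  forall E : set (Rn R d), measurable E ->
    (exists M : R, forall x, E x -> enorm x <= M) ->
    totally_bounded (fun y z : B => (`|y - z|)%:E)
      [set bochner_integral leb E f | f in F].

End kolmogorov_riesz.

(* Main.v *)
Require Import Defs.
From HB Require Import structures.
From mathcomp Require Import all_boot all_order all_algebra.
From mathcomp Require Import all_classical all_reals all_analysis.
From mathcomp Require Import measurable_realfun.
From mathcomp Require Import ring lra zify.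
Set Implicit Arguments.
Unset Strict Implicit.
Unset Printing Implicit Defensive.
Import Order.TTheory GRing.Theory Num.Theory.
Import numFieldNormedType.Exports.
Local Open Scope classical_set_scope.
Local Open Scope ring_scope.

(** A totally bounded subset of L^p(R^d; B) is characterized by comparing each
    function with its averages over the cells of a fine grid of cubes.

    Step functions on such grids, with bounded support, are dense
    ([grid_step_dense]). Borel sets can be approximated by unions of cells since
    the sets for which this is possible form a sigma-algebra; measurable sets are
    nearly Borel by the definition of the outer measure, and a Bochner measurable
    function is a dominated limit of simple functions.

    Necessity. Up to any e, a totally bounded family is a finite set of step
    functions ([totally_bounded_grid_steps]). A step function vanishes far away,
    and it moves little under small translations because it changes only in thin
    slabs along the faces of the grid ([grid_step_translate]). Both properties
    pass to the family because translations are isometries. The map that takes f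
    to its integral over a set E of finite measure is continuous for the norm of
    order p, as u <= l + l (u / l)^p for every l > 0 ([integral_patch_le]).

    Sufficiency. Let P f be the function that is equal, on each cell of side 1 / n
    of a large cube, to the average of f over the cell, and is zero outside the
    cube. If the translates of f by vectors with coordinates at most 1 / n in
    absolute value, and the part of f outside the cube, account for at most s,
    then f - P f has norm at most a constant, which depends only on d, times s
    ([cell_average_approx]). The usual proof of this integrates
    |f (x + h) - f x|^p in x and h. Here it is proved for step functions on a
    refinement of the grid, where the average over h is a finite sum and
    Minkowski's inequality suffices ([cell_average_dist]), and extended by
    density, both sides being continuous at fixed n. Now P f is determined by the
    integrals of f over finitely many cells, each of which ranges over a totally
    bounded subset of B; hence the family is covered by finitely many sets on
    which P f varies little, and these sets have small diameter. *)

(** * Simple functions and Bochner measurability *)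

Lemma patch0E (T : Type) (V : zmodType) (E : set T) (f : T -> V) x :
  patch (fun=> 0) E f x = if x \in E then f x else 0.
Proof. by []. Qed.

Section simple_functions.
Context d (T : measurableType d) (R : realType).
Variable mu : {measure set T -> \bar R}.
Implicit Types B : completeNormedModType R.

Lemma bochner_simple_preimage B (s : T -> B) (Y : set B) :
  bochner_simple mu s -> measurable (s @^-1` Y).
Proof.
move=> [fs ms _].
rewrite [X in measurable X](_ : _ = \bigcup_(b in range s `&` Y) s @^-1` [set b]).
  by apply: fin_bigcup_measurable => //; exact: finite_setIl.
apply/seteqP; split => [x Yx|x [b [_ Yb] /= sxb]] /=; last by rewrite sxb.
by exists (s x).
Qed.

Lemma bochner_simple_support B (s : T -> B) :
  bochner_simple mu s -> (mu (s @^-1` [set~ 0%R]) < +oo)%E.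
Proof.
move=> ss; have [fs ms mus] := ss.
rewrite [X in mu X](_ : _ = \bigcup_(b in range s `\ 0) s @^-1` [set b]).
  have fD : finite_set (range s `\ 0) by exact: finite_setD.
  rewrite measure_fin_bigcup//; last first.
    apply/trivIsetP => b c _ _ bc; rewrite -subset0 => x [/= -> /eqP].
    by rewrite (negbTE bc).
  rewrite fsbig_finite//= big_seq lte_sum_pinfty// => b.
  by rewrite in_fset_set// inE => -[_ /eqP] /mus.
apply/seteqP; split => [x sx0|x [b [_ b0] /= ->]//] /=.
by exists (s x).
Qed.

Lemma bochner_simpleP B (s : T -> B) : finite_set (range s) ->
  (forall Y, measurable (s @^-1` Y)) -> (mu (s @^-1` [set~ 0%R]) < +oo)%E ->
  bochner_simple mu s.
Proof.
move=> fs ms mus; split => // b b0; apply: le_lt_trans mus.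
by apply: le_measure; rewrite ?inE// => x /= ->; exact/eqP.
Qed.

Lemma bochner_simple_op2 B B1 B2 (op : B1 -> B2 -> B) (s : T -> B1)
    (t : T -> B2) : op 0 0 = 0 ->
  bochner_simple mu s -> bochner_simple mu t ->
  bochner_simple mu (fun x => op (s x) (t x)).
Proof.
move=> op0 ss st; have [[fs _ _] [ft _ _]] := (ss, st).
have mst (Y : set B) : measurable ((fun x => op (s x) (t x)) @^-1` Y).
  rewrite [X in measurable X](_ : _ = \bigcup_(b in range s)
      (s @^-1` [set b] `&` t @^-1` [set c | Y (op b c)])).
    apply: fin_bigcup_measurable => // b _.
    by apply: measurableI; exact: bochner_simple_preimage.
  apply/seteqP; split => [x Yx|x [b _ [/= <-]]//] /=.
  by exists (s x) => //.
apply: bochner_simpleP => //.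
  apply: sub_finite_set (finite_image2 op fs ft) => _ [x _ <-] /=.
  by exists (s x); [exists x|exists (t x) => //; exists x].
apply: (@le_lt_trans _ _ (mu (s @^-1` [set~ 0%R] `|` t @^-1` [set~ 0%R]))).
  apply: le_measure; rewrite ?inE//.
    by apply: measurableU; exact: bochner_simple_preimage.
  move=> x /= stx; apply/not_andP => -[sx tx]; apply: stx.
  by rewrite sx tx.
apply: le_lt_trans (measureU2 _ _ _) _;
  [exact: bochner_simple_preimage|exact: bochner_simple_preimage|].
by rewrite lte_add_pinfty//; exact: bochner_simple_support.
Qed.

Lemma measurable_patch_preimage B (f : T -> B) (E : set T) (Y : set B) :
  measurable E -> measurable (f @^-1` Y) ->
  measurable (patch (fun=> 0) E f @^-1` Y).
Proof.
move=> mE mf.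
rewrite [X in measurable X](_ : _ =
    (E `&` f @^-1` Y) `|` (~` E `&` (cst 0 : T -> B) @^-1` Y)).
  apply: measurableU; apply: measurableI => //; first exact: measurableC.
  by rewrite preimage_cst; case: ifP => // _; exact: measurable0.
apply/seteqP; split => x /=; rewrite patch0E; case: ifPn.
- by rewrite inE => Ex ?; left.
- by rewrite notin_setE => Ex ?; right.
- by rewrite inE => Ex [[]|[]].
- by rewrite notin_setE => Ex [[]|[]].
Qed.

Lemma bochner_simple_patch B (s : T -> B) (E : set T) : measurable E ->
  bochner_simple mu s -> bochner_simple mu (patch (fun=> 0) E s).
Proof.
move=> mE ss; have [fs _ _] := ss.
have ms Y : measurable (s @^-1` Y) by exact: bochner_simple_preimage.
apply: bochner_simpleP.
- apply: (@sub_finite_set _ _ (range s `|` [set 0])); last by rewrite finite_setU.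
  move=> _ [x _ <-]; rewrite patch0E; case: ifPn => _; last by right.
  by left; exists x.
- by move=> Y; exact: measurable_patch_preimage.
- apply: le_lt_trans (bochner_simple_support ss).
  apply: le_measure; rewrite ?inE//; first exact: measurable_patch_preimage.
  by move=> x /=; rewrite patch0E; case: ifPn.
Qed.

Lemma bochner_simple_cst0 B : bochner_simple mu (fun=> (0 : B)).
Proof.
apply: bochner_simpleP.
- by apply: (sub_finite_set _ (finite_set1 0)) => _ [x _ <-].
- by move=> Y; rewrite preimage_cst; case: ifP.
- rewrite (_ : _ @^-1` _ = set0) ?measure0//.
  by apply/seteqP; split => x //= /(_ erefl).
Qed.

Lemma bochner_simple_indic B (E : set T) (b : B) : measurable E ->
  (mu E < +oo)%E -> bochner_simple mu (patch (fun=> 0) E (fun=> b)).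
Proof.
move=> mE muE.
have mb (Y : set B) : measurable ((fun=> b : B) @^-1` Y : set T).
  by rewrite preimage_cst; case: ifP => // _; exact: measurable0.
apply: bochner_simpleP.
- apply: (@sub_finite_set _ _ ([set b] `|` [set 0])); last by rewrite finite_setU.
  by move=> _ [x _ <-]; rewrite patch0E; case: ifPn => _; [left|right].
- by move=> Y; exact: measurable_patch_preimage.
- apply: le_lt_trans muE; apply: le_measure; rewrite ?inE//.
    exact: measurable_patch_preimage.
  by move=> x /=; rewrite patch0E; case: ifPn => //; rewrite inE.
Qed.

Lemma bochner_simple_normr B (s : T -> B) :
  bochner_simple mu s -> measurable_fun setT (fun x => `|s x|).
Proof.
move=> ss _ Y _; rewrite setTI.
exact: (bochner_simple_preimage [set b | Y `|b|] ss).
Qed.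

Lemma bochner_simpleB B (s t : T -> B) : bochner_simple mu s ->
  bochner_simple mu t -> bochner_simple mu (fun x => s x - t x).
Proof. exact: (bochner_simple_op2 (op := fun a b => a - b) (subr0 0)). Qed.

Lemma bochner_simpleD B (s t : T -> B) : bochner_simple mu s ->
  bochner_simple mu t -> bochner_simple mu (fun x => s x + t x).
Proof. exact: (bochner_simple_op2 (op := +%R) (addr0 0)). Qed.

End simple_functions.

Section bochner_measurability.
Context d (T : measurableType d) (R : realType).
Variable mu : {measure set T -> \bar R}.
Variable B : completeNormedModType R.
Implicit Types f g : T -> B.

Lemma bochner_simple_measurable f :
  bochner_simple mu f -> bochner_measurable mu f.
Proof.
by move=> sf; exists (fun=> f); split => //; apply: aeW => x; exact: cvg_cst.
Qed.

Lemma bochner_measurableD f g : bochner_measurable mu f ->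
  bochner_measurable mu g -> bochner_measurable mu (fun x => f x + g x).
Proof.
move=> [s [ss sf]] [t [st tg]]; exists (fun n x => s n x + t n x); split.
  by move=> n; exact: bochner_simpleD.
by apply: filterS2 sf tg => x sx tx; exact: cvgD.
Qed.

Lemma bochner_measurableB f g : bochner_measurable mu f ->
  bochner_measurable mu g -> bochner_measurable mu (fun x => f x - g x).
Proof.
move=> [s [ss sf]] [t [st tg]]; exists (fun n x => s n x - t n x); split.
  by move=> n; exact: bochner_simpleB.
by apply: filterS2 sf tg => x sx tx; exact: cvgB.
Qed.

Lemma bochner_measurable_patch f (E : set T) : measurable E ->
  bochner_measurable mu f -> bochner_measurable mu (patch (fun=> 0) E f).
Proof.
move=> mE [s [ss sf]]; exists (fun n => patch (fun=> 0) E (s n)); split.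
  by move=> n; exact: bochner_simple_patch.
apply: filterS sf => x sx; rewrite [X in _ --> X]patch0E.
by under eq_cvg do rewrite patch0E; case: ifPn => // _; exact: cvg_cst.
Qed.

Hypothesis cmu : measure_is_complete mu.

(** The norms of the approximating simple functions converge only almost
    everywhere; completeness of the measure is what makes such a limit
    measurable. *)
Lemma bochner_measurable_normr f :
  bochner_measurable mu f -> measurable_fun setT (fun x => `|f x|).
Proof.
move=> [s [ss [N [mN N0 sN]]]].
pose g (x : T) : R := if x \in N then 0 else `|f x|.
have mg : measurable_fun setT g.
  apply: (@measurable_fun_cvg _ _ _ _
    (fun n x => if x \in N then 0 else `|s n x|)).
    move=> n; apply: measurable_fun_ifT => //.
      apply: (measurable_fun_bool true).
      rewrite setTI [X in measurable X](_ : _ = N)//.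
      by apply/seteqP; split => x /= => [/set_mem|/mem_set].
    exact: bochner_simple_normr.
  move=> x _; rewrite /g; case: ifPn => [_|]; first exact: cvg_cst.
  rewrite notin_setE => Nx; apply: cvg_norm.
  by apply: contrapT => h; apply: Nx; exact: sN.
apply/measurable_EFinP; apply: (@ae_measurable_fun _ _ _ _ cmu _ (EFin \o g)).
  exists N; split => // x /= gf; apply: contrapT => Nx; apply: gf => _.
  by rewrite /g /= ifF//; apply/negbTE; rewrite notin_setE.
exact/measurable_EFinP.
Qed.

End bochner_measurability.

(** * Norms of order p and density of simple functions *)

Lemma cvge_lt (R : realType) (I : Type) (F : set_system I) {FF : Filter F}
    (u : I -> \bar R) (l a : \bar R) :
  u x @[x --> F] --> l -> (l < a)%E -> \forall x \near F, (u x < a)%E.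
Proof.
move=> ul la; apply: (ul [set y | (y < a)%E]); apply: open_nbhs_nbhs.
by split => //; exact: open_ereal_lt_ereal.
Qed.

Section Lp_norm.
Context d (T : measurableType d) (R : realType).
Variable mu : {measure set T -> \bar R}.
Variable p : R.
Hypothesis p1 : 1 <= p.
Implicit Types B : completeNormedModType R.

Let p_gt0 : 0 < p. Proof. exact: lt_le_trans p1. Qed.

Let p_neq0 : p != 0. Proof. by rewrite gt_eqF. Qed.

Lemma bochner_LnormE B (f : T -> B) : bochner_Lnorm mu p f =
  ((\int[mu]_x (`|f x| `^ p)%:E) `^ p^-1)%E.
Proof.
rewrite /bochner_Lnorm unlock; congr (_ `^ _)%E; apply: eq_integral => x _.
by rewrite /= normr_id.
Qed.

Lemma integral_powR_ge0 B (f : T -> B) :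
  (0 <= \int[mu]_x (`|f x| `^ p)%:E)%E.
Proof. by apply: integral_ge0 => x _; rewrite lee_fin powR_ge0. Qed.

Lemma bochner_Lnorm_lt B (f : T -> B) (e : R) : 0 <= e ->
  ((bochner_Lnorm mu p f < e%:E) =
   (\int[mu]_x (`|f x| `^ p)%:E < (e `^ p)%:E))%E.
Proof.
move=> e0; have I0 := integral_powR_ge0 f; rewrite bochner_LnormE.
set I := (\int[mu]_x _)%E in I0 *.
rewrite !ltNge; congr (~~ _); apply/idP/idP => h.
- have -> : I = ((I `^ p^-1) `^ p)%E by rewrite -poweRrM mulVf// poweRe1.
  rewrite -poweR_EFin; apply: gt0_ler_poweR => //.
  + exact: ltW.
  + by rewrite in_itv/= lee_fin e0 leey.
  + by rewrite in_itv/= poweR_ge0 leey.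
- have -> : e%:E = ((e `^ p)%:E `^ p^-1)%E.
    by rewrite poweR_EFin -powRrM mulfV// powRr1.
  apply: gt0_ler_poweR => //.
  + by rewrite invr_ge0 ltW.
  + by rewrite in_itv/= lee_fin powR_ge0 leey.
  + by rewrite in_itv/= I0 leey.
Qed.

Lemma bochner_Lnorm_lty B (f : T -> B) :
  ((bochner_Lnorm mu p f < +oo) =
   (\int[mu]_x (`|f x| `^ p)%:E < +oo))%E.
Proof.
rewrite bochner_LnormE; apply/idP/idP => [|h]; last exact: poweR_lty.
by apply: lty_poweRy; rewrite invr_eq0.
Qed.

Lemma measurable_EFin_powR (u : T -> R) (mf : measurable_fun setT u) :
  measurable_fun setT (fun x => (u x `^ p)%:E).
Proof.
by apply/measurable_EFinP; exact: (@measurableT_comp _ _ _ _ _ _ (@powR R ^~ p)).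
Qed.

(** Since only the norms enter, two functions with values in different spaces
    can be compared. *)
Lemma le_bochner_Lnorm B B' (f : T -> B) (g : T -> B') :
  measurable_fun setT (fun x => `|f x|) ->
  measurable_fun setT (fun x => `|g x|) ->
  (forall x, `|f x| <= `|g x|) ->
  (bochner_Lnorm mu p f <= bochner_Lnorm mu p g)%E.
Proof.
move=> mf mg fg; rewrite !bochner_LnormE; apply: gt0_ler_poweR.
- by rewrite invr_ge0 ltW.
- by rewrite in_itv/= integral_powR_ge0 leey.
- by rewrite in_itv/= integral_powR_ge0 leey.
- apply: ge0_le_integral => //.
  + exact: (measurable_EFin_powR mf).
  + exact: (measurable_EFin_powR mg).
  + by move=> x _; rewrite lee_fin (ge0_ler_powR (ltW p_gt0)) ?nnegrE.
Qed.

Lemma Lnorm_scale (u : T -> R) (a : R) : 0 <= a -> measurable_fun setT u ->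
  (Lnorm mu p%:E (EFin \o (fun x => a * u x)%R) =
   a%:E * Lnorm mu p%:E (EFin \o u))%E.
Proof.
move=> a0 mu'; rewrite unlock.
under eq_integral do rewrite /= normrM ger0_norm// powRM//.
under eq_integral do rewrite EFinM.
rewrite ge0_integralZl_EFin//.
- rewrite poweRM ?lee_fin ?powR_ge0//.
    by rewrite poweR_EFin -powRrM mulfV// powRr1.
  by apply: integral_ge0 => x _; rewrite lee_fin powR_ge0.
- by apply: measurable_EFin_powR; exact: measurableT_comp.
- exact: powR_ge0.
Qed.

Lemma Lnorm_sum (J : Type) (r : seq J) (u : J -> T -> R) :
  (forall j, measurable_fun setT (u j)) ->
  (Lnorm mu p%:E (EFin \o (fun x => \sum_(j <- r) u j x)%R) <=
   \sum_(j <- r) Lnorm mu p%:E (EFin \o u j))%E.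
Proof.
move=> mu'; elim: r => [|j r IH].
  rewrite big_nil (_ : _ \o _ = cst 0%E) ?Lnorm0 ?eqe//.
  by apply/funext => x /=; rewrite big_nil.
rewrite big_cons (_ : _ \o _ =
    EFin \o (u j \+ (fun x => \sum_(j <- r) u j x))%R); last first.
  by apply/funext => x /=; rewrite big_cons.
apply: (le_trans (minkowski_EFin _ _ _ p1)) => //.
  exact: measurable_sum.
by rewrite leeD2l.
Qed.

Lemma bochner_Lnorm_le_sum B (J : Type) (r : seq J) (f : T -> B)
    (u : J -> T -> B) (a : R) : 0 <= a ->
  measurable_fun setT (fun x => `|f x|) ->
  (forall j, measurable_fun setT (fun x => `|u j x|)) ->
  (forall x, `|f x| <= a * \sum_(j <- r) `|u j x|) ->
  (bochner_Lnorm mu p f <= a%:E * \sum_(j <- r) bochner_Lnorm mu p (u j))%E.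
Proof.
move=> a0 mf mu' fu.
pose v x : R := a * \sum_(j <- r) `|u j x|.
have mv : measurable_fun setT (fun x => \sum_(j <- r) `|u j x|).
  exact: measurable_sum.
apply: (@le_trans _ _ (Lnorm mu p%:E (EFin \o v))).
  have -> : Lnorm mu p%:E (EFin \o v) = bochner_Lnorm mu p (v : T -> R^o).
    rewrite /bochner_Lnorm; apply: eq_Lnorm => x /=; rewrite ger0_norm//.
    by rewrite mulr_ge0// sumr_ge0.
  apply: le_bochner_Lnorm => //.
    by apply: measurableT_comp => //; exact: measurable_funM.
  by move=> x; rewrite (le_trans (fu x))// ler_norm.
rewrite Lnorm_scale// lee_wpmul2l ?lee_fin//.
exact: Lnorm_sum (fun j => mu' j).
Qed.

Lemma bochner_Lnorm_triangle B (f g h : T -> B) :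
  measurable_fun setT (fun x => `|f x|) ->
  measurable_fun setT (fun x => `|g x|) ->
  measurable_fun setT (fun x => `|h x|) ->
  (forall x, `|f x| <= `|g x| + `|h x|) ->
  (bochner_Lnorm mu p f <= bochner_Lnorm mu p g + bochner_Lnorm mu p h)%E.
Proof.
move=> mf mg mh fgh.
have := @bochner_Lnorm_le_sum _ bool [:: true; false] f
  (fun b => if b then g else h) 1 ler01 mf.
rewrite !big_cons big_nil /= adde0 mul1e; apply; first by case.
by move=> x; rewrite !big_cons big_nil addr0 mul1r.
Qed.

Lemma eq_bochner_Lnorm B B' (f : T -> B) (g : T -> B') :
  (forall x, `|f x| = `|g x|) -> bochner_Lnorm mu p f = bochner_Lnorm mu p g.
Proof. by move=> fg; apply: eq_Lnorm => x; rewrite fg. Qed.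

(** This is what turns finitely many small differences of cell averages over
    a cube into a small norm. *)
Lemma bochner_Lnorm_small (E : set T) (e : R) : measurable E ->
  (mu E < +oo)%E -> 0 < e ->
  exists2 eta : R, 0 < eta & forall B (f : T -> B),
    measurable_fun setT (fun x => `|f x|) ->
    (forall x, `|f x| <= eta * \1_E x) -> (bochner_Lnorm mu p f < e%:E)%E.
Proof.
move=> mE muE e0.
pose m := fine (mu E); have m0 : 0 <= m by rewrite fine_ge0.
(* The summand 1 covers the case of a null set, the factor 1 / 2 is slack
   for the strict inequality. *)
pose eta := (e `^ p / (m + 1)) `^ p^-1 / 2.
have q0 : 0 < e `^ p / (m + 1) by rewrite divr_gt0 ?powR_gt0// ltr_wpDl.
have eta0 : 0 < eta by rewrite divr_gt0 ?powR_gt0.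
exists eta => // B f mf fE; rewrite bochner_Lnorm_lt ?ltW//.
apply: (@le_lt_trans _ _ (\int[mu]_x ((eta `^ p)%:E * (\1_E x)%:E))%E).
  apply: ge0_le_integral => //.
  - exact: (measurable_EFin_powR mf).
  - apply: measurable_funeM; exact/measurable_EFinP/measurable_indic.
  - move=> x _; rewrite -EFinM lee_fin.
    have -> : eta `^ p * \1_E x = (eta * \1_E x) `^ p.
      rewrite powRM//; last exact: ltW.
      by rewrite indicE; case: (_ \in _); rewrite ?powR1// powR0.
    rewrite (ge0_ler_powR (ltW p_gt0)) ?nnegrE//.
    by rewrite mulr_ge0// ltW.
rewrite ge0_integralZl_EFin//; last 2 first.
  - exact/measurable_EFinP/measurable_indic.
  - exact: powR_ge0.
rewrite integral_indic// setIT -(@fineK _ (mu E)); last by rewrite ge0_fin_numE.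
rewrite -EFinM lte_fin -/m.
have : eta `^ p <= e `^ p / (m + 1).
  have -> : e `^ p / (m + 1) = ((e `^ p / (m + 1)) `^ p^-1) `^ p.
    by rewrite -powRrM mulVf// powRr1// ltW.
  rewrite (ge0_ler_powR (ltW p_gt0)) ?nnegrE ?powR_ge0//; first exact: ltW.
  by rewrite ler_pdivrMr// ler_peMr ?powR_ge0// ler1n.
move=> /(ler_wpM2r m0)/le_lt_trans; apply.
by rewrite mulrAC ltr_pdivrMr ?ltr_wpDl// ltr_pM2l ?powR_gt0// ltrDl.
Qed.

End Lp_norm.

Section simple_approximation.
Context d (T : measurableType d) (R : realType).
Variable mu : {measure set T -> \bar R}.
Hypothesis cmu : measure_is_complete mu.
Variable B : completeNormedModType R.
Implicit Types f g : T -> B.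

(** Cutting off the simple functions where they exceed twice the norm of the
    limit makes the convergence dominated. *)
Lemma bochner_simple_dense (p : R) f (e : R) : 1 <= p ->
  bochner_measurable mu f -> (bochner_Lnorm mu p f < +oo)%E -> 0 < e ->
  exists2 s, bochner_simple mu s &
    (bochner_Lnorm mu p (fun x => f x - s x)%R < e%:E)%E.
Proof.
move=> p1 mf foo e0.
have p0 : 0 < p by exact: lt_le_trans p1.
have mnf := bochner_measurable_normr cmu mf.
have [s [ss sf]] := mf.
pose E n := [set x | `|s n x| <= 2 * `|f x|].
have mE n : measurable (E n).
  rewrite -[E n]setTI.
  have H := @measurable_fun_ler _ T R setT _ (fun x => 2 * `|f x|)
    (bochner_simple_normr (ss n)).
  have /H/(_ measurableT [set true]) : measurable_fun setT (fun x => 2 * `|f x|).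
    exact: measurable_funM.
  exact.
pose t n := patch (fun=> 0) (E n) (s n).
have st n : bochner_simple mu (t n) by exact: bochner_simple_patch.
have tf x : s n x @[n --> \oo] --> f x -> t n x @[n --> \oo] --> f x.
  move=> sx; have [f0|f0] := eqVneq (f x) 0.
    rewrite f0 (_ : (fun n => t n x) = fun=> 0); first exact: cvg_cst.
    apply/funext => n; rewrite /t patch0E; case: ifPn => //; rewrite inE /E /=.
    by rewrite f0 normr0 mulr0 normr_le0 => /eqP.
  have nsx : `|s n x| @[n --> \oo] --> `|f x| by apply: cvg_norm.
  apply: cvg_trans sx; apply: near_eq_cvg.
  near=> n; rewrite /t patch0E ifT// inE /E /=.
  apply: ltW; near: n.
  by apply: (cvgr_lt _ nsx); rewrite ltr_pMl ?normr_gt0// ltr1n.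
have dom n x : `|f x - t n x| <= 3 * `|f x|.
  rewrite (le_trans (ler_normB _ _))// /t patch0E; case: ifPn.
    rewrite inE /E /= => h; rewrite (le_trans (lerD (lexx _) h))//.
    by lra.
  by rewrite normr0 addr0 ler_peMl// ler1n.
have mft n : measurable_fun setT (fun x => `|f x - t n x|).
  apply: (bochner_measurable_normr cmu); apply: bochner_measurableB => //.
  exact: bochner_simple_measurable.
have [|||_ _ /=] := @dominated_convergence _ T R mu setT measurableT
  (fun n x => (`|f x - t n x| `^ p)%:E) (fun=> 0%E)
  (fun x => ((3 * `|f x|) `^ p)%:E)
  (fun n => measurable_EFin_powR p (mft n)) (measurable_cst _).
- apply: filterS sf => x /tf tx _.
  apply: cvg_EFin; first exact: nearW.
  apply/cvgr0Pnorm_lt => r r0.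
  have /cvgr0Pnorm_lt/(_ (r `^ p^-1)) : (f x - t n x) @[n --> \oo] --> (0 : B).
    by rewrite -(subrr (f x)); apply: cvgB => //; exact: cvg_cst.
  rewrite powR_gt0// => /(_ isT); apply: filterS => n h.
  rewrite /= ger0_norm ?powR_ge0//.
  rewrite [ltRHS](_ : r = (r `^ p^-1) `^ p).
    by rewrite gt0_ltr_powR// nnegrE// powR_ge0.
  by rewrite -powRrM mulVf ?gt_eqF// powRr1// ltW.
- apply/integrableP; split.
    by apply: (measurable_EFin_powR p); exact: measurable_funM.
  under eq_integral do rewrite gee0_abs ?lee_fin ?powR_ge0// powRM// EFinM.
  rewrite ge0_integralZl_EFin ?powR_ge0//; last first.
    exact: (measurable_EFin_powR p mnf).
  by rewrite lte_mul_pinfty ?lee_fin ?powR_ge0// -bochner_Lnorm_lty.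
- apply: aeW => x n _; rewrite gee0_abs ?lee_fin ?powR_ge0//.
  by rewrite (ge0_ler_powR (ltW p0)) ?nnegrE ?mulr_ge0.
rewrite integral0 => cv0.
have : \forall n \near \oo,
    (\int[mu]_x (`|f x - t n x| `^ p)%:E < (e `^ p)%:E)%E.
  by apply: cvge_lt cv0 _; rewrite lte_fin powR_gt0.
move=> [n _ /(_ n (leqnn n)) /= hn]; exists (t n) => //.
by rewrite bochner_Lnorm_lt// ltW.
Unshelve. all: by end_near. Qed.
End simple_approximation.

(** * The Bochner integral *)

Section bochner_integral_theory.
Context d (T : measurableType d) (R : realType).
Variable mu : {measure set T -> \bar R}.
Variable B : completeNormedModType R.
Implicit Types f g s t : T -> B.

(** The value of the integral of a simple function can be computed on any
    finite partition on the pieces of which it is constant; this is how two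
    simple functions are compared, on their common refinement. *)
Lemma simple_integral_partition (J : choiceType) (D : set J) (tau : T -> J)
    (phi : J -> B) : finite_set D -> (forall x, D (tau x)) ->
  (forall j, measurable (tau @^-1` [set j])) ->
  (forall j, phi j != 0 -> (mu (tau @^-1` [set j]) < +oo)%E) ->
  simple_integral mu (phi \o tau) =
  \sum_(j \in D) fine (mu (tau @^-1` [set j])) *: phi j.
Proof.
move=> fD Dtau mtau mutau; rewrite /simple_integral.
have frg : finite_set (range (phi \o tau)).
  apply: sub_finite_set (finite_image phi fD) => _ [x _ <-].
  by exists (tau x).
pose F b j := if phi j == b then fine (mu (tau @^-1` [set j])) *: b else 0.
transitivity (\sum_(b \in range (phi \o tau)) \sum_(j \in D) F b j).
  apply: eq_fsbigr => b _; have [->|b0] := eqVneq b 0.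
    rewrite scaler0 fsbig1// => j _; rewrite /F; case: ifP => // _.
    by rewrite scaler0.
  rewrite (_ : _ @^-1` _ = \bigcup_(j in D)
      (if phi j == b then tau @^-1` [set j] else set0)); last first.
    apply/seteqP; split => [x /= xb|x [j _]].
      by exists (tau x); rewrite ?xb ?eqxx.
    by case: eqVneq => // <- /= ->.
  rewrite measure_fin_bigcup//; last 2 first.
  - apply/trivIsetP => i j _ _ ij; rewrite -subset0 => x [].
    case: ifP => // _ /= xi; case: ifP => // _ /= xj.
    by move: ij; rewrite -xi -xj eqxx.
  - by move=> j _; case: ifP.
  rewrite !fsbig_finite//= -sum_fine; last first.
    move=> j _; case: eqVneq => [jb|_]; last by rewrite measure0.
    by rewrite ge0_fin_numE// mutau// jb.
  rewrite scaler_suml; apply: eq_bigr => j _; rewrite /F.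
  by case: ifP; rewrite // measure0 scale0r.
rewrite exchange_fsbig//; apply: eq_fsbigr => j _.
have [rj|rj] := pselect (range (phi \o tau) (phi j)).
  rewrite (fsbigD1 (phi j))//= fsbig1 ?addr0; first by rewrite /F eqxx.
  by move=> b [_ /= /eqP]; rewrite /F eq_sym => /negbTE ->.
rewrite fsbig1; last first.
  by move=> b rb; rewrite /F; case: eqVneq => // jb; rewrite -jb in rb.
rewrite (_ : _ @^-1` _ = set0) ?measure0 ?scale0r//.
by rewrite -subset0 => x /= xj; apply: rj; exists x => //=; rewrite xj.
Qed.

Lemma integral_normr_partition (J : choiceType) (D : set J) (tau : T -> J)
    (phi : J -> B) : finite_set D -> (forall x, D (tau x)) ->
  (forall j, measurable (tau @^-1` [set j])) ->
  (\int[mu]_x (`|phi (tau x)|)%:E =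
  \sum_(j \in D) (`|phi j|)%:E * mu (tau @^-1` [set j]))%E.
Proof.
move=> fD Dtau mtau.
transitivity (\int[mu]_x \sum_(j \in D)
    (`|phi j|%:E * (\1_(tau @^-1` [set j]) x)%:E))%E.
  apply: eq_integral => x _; rewrite (fsbigD1 (tau x))//= fsbig1.
    by rewrite adde0 indicE mem_set// mule1.
  move=> j [_ /= jx]; rewrite indicE memNset ?mule0// => /= xj.
  by apply: jx.
rewrite ge0_integral_fsum//; last first.
  move=> j; apply: measurable_funeM.
  exact/measurable_EFinP/measurable_indic.
apply: eq_fsbigr => j _; rewrite ge0_integralZl_EFin//.
  by rewrite integral_indic// setIT.
exact/measurable_EFinP/measurable_indic.
Qed.

(** This one inequality, on the common refinement of s and t, is all that is
    used of the integral of simple functions: existence, uniqueness and the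
    Lipschitz dependence of the Bochner integral on the integrand are deduced
    from it, without a separate proof of linearity. *)
Lemma simple_integral_dist s t : bochner_simple mu s -> bochner_simple mu t ->
  ((`|simple_integral mu s - simple_integral mu t|)%:E <=
   \int[mu]_x (`|s x - t x|)%:E)%E.
Proof.
move=> ss st; have [[fs ms mus] [ft mt mut]] := (ss, st).
pose tau x := (s x, t x); pose D := range s `*` range t.
have fD : finite_set D by exact: finite_setX.
have Dtau x : D (tau x) by split; exists x.
have tauE (q : B * B) :
    tau @^-1` [set q] = s @^-1` [set q.1] `&` t @^-1` [set q.2].
  by apply/seteqP; split => x /=; case: q => a b /=; [case|case=> <- <-].
have mtau q : measurable (tau @^-1` [set q]).
  by rewrite tauE; apply: measurableI.
have mus' (q : B * B) : q.1 != 0 -> (mu (tau @^-1` [set q]) < +oo)%E.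
  move=> /mus; apply: le_lt_trans; apply: le_measure; rewrite ?inE//.
  by rewrite tauE; apply: subIsetl.
have mut' (q : B * B) : q.2 != 0 -> (mu (tau @^-1` [set q]) < +oo)%E.
  move=> /mut; apply: le_lt_trans; apply: le_measure; rewrite ?inE//.
  by rewrite tauE; apply: subIsetr.
rewrite (simple_integral_partition fD Dtau mtau mus' : simple_integral mu s = _).
rewrite (simple_integral_partition fD Dtau mtau mut' : simple_integral mu t = _).
rewrite (integral_normr_partition (fun q => q.1 - q.2) fD Dtau mtau).
rewrite !fsbig_finite//= -sumrB.
apply: (@le_trans _ _ (\sum_(q <- finmap.enum_fset (fset_set D))
   `|fine (mu (tau @^-1` [set q])) *: q.1 -
     fine (mu (tau @^-1` [set q])) *: q.2|)%:E).
  by rewrite lee_fin ler_norm_sum.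
rewrite -sumEFin; apply: lee_sum => q _.
rewrite -scalerBr normrZ ger0_norm ?fine_ge0//.
(* The piece where both functions vanish may have infinite measure. *)
have [->|q12] := eqVneq (q.1 - q.2) 0; first by rewrite normr0 mulr0 mul0e.
rewrite EFinM muleC fineK// ge0_fin_numE//.
have [q1|/mus'//] := eqVneq q.1 0.
by apply: mut'; move: q12; rewrite q1 sub0r oppr_eq0.
Qed.

Hypothesis cmu : measure_is_complete mu.

Let normB_measurable f g : bochner_measurable mu f -> bochner_measurable mu g ->
  measurable_fun setT (fun x => (`|f x - g x|)%:E).
Proof.
move=> mf mg; apply/measurable_EFinP.
by apply: (bochner_measurable_normr cmu); exact: bochner_measurableB.
Qed.

Lemma integral_normr_triangle f g h : bochner_measurable mu f ->
  bochner_measurable mu g -> bochner_measurable mu h ->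
  (\int[mu]_x (`|f x - h x|)%:E <=
   \int[mu]_x (`|f x - g x|)%:E + \int[mu]_x (`|g x - h x|)%:E)%E.
Proof.
move=> mf mg mh; rewrite -ge0_integralD//; [|exact: normB_measurable..].
apply: ge0_le_integral => //; first exact: normB_measurable.
- by apply: emeasurable_funD; exact: normB_measurable.
- move=> x _; rewrite -EFinD lee_fin.
  by rewrite (le_trans _ (ler_normD _ _))// addrA subrK.
Qed.

Lemma integral_normr_sym f g :
  (\int[mu]_x (`|f x - g x|)%:E = \int[mu]_x (`|g x - f x|)%:E)%E.
Proof. by apply: eq_integral => x _; rewrite distrC. Qed.

Lemma is_bochner_integral_dist f g y z :
  is_bochner_integral mu f y -> is_bochner_integral mu g z ->
  ((`|y - z|)%:E <= \int[mu]_x (`|f x - g x|)%:E)%E.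
Proof.
move=> [mf [s [ss sf Is]]] [mg [t [st tg It]]].
apply/lee_addgt0Pr => e e0.
have e4 : 0 < e / 4 by rewrite divr_gt0.
have H1 : \forall n \near \oo, (\int[mu]_x (`|f x - s n x|)%:E < (e/4)%:E)%E.
  by apply: cvge_lt sf _.
have H2 : \forall n \near \oo, (\int[mu]_x (`|g x - t n x|)%:E < (e/4)%:E)%E.
  by apply: cvge_lt tg _.
have H3 : \forall n \near \oo, `|y - simple_integral mu (s n)| < e/4.
  by move/cvgrPdist_lt : Is; apply.
have H4 : \forall n \near \oo, `|z - simple_integral mu (t n)| < e/4.
  by move/cvgrPdist_lt : It; apply.
near \oo => n.
have K1 : (\int[mu]_x (`|f x - s n x|)%:E < (e/4)%:E)%E by near: n.
have K2 : (\int[mu]_x (`|g x - t n x|)%:E < (e/4)%:E)%E by near: n.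
have K3 : `|y - simple_integral mu (s n)| < e/4 by near: n.
have K4 : `|z - simple_integral mu (t n)| < e/4 by near: n.
have ms := bochner_simple_measurable (ss n).
have mt := bochner_simple_measurable (st n).
have Ist := simple_integral_dist (ss n) (st n).
have T1 := integral_normr_triangle ms mf mt.
have T2 := integral_normr_triangle mf mg mt.
rewrite (integral_normr_sym (s n) f) in T1.
set I := (\int[mu]_x (`|f x - g x|)%:E)%E in T2 *.
apply: (@le_trans _ _ ((`|simple_integral mu (s n) -
    simple_integral mu (t n)|)%:E + (e/4 + e/4)%:E)%E).
  rewrite -EFinD lee_fin; set a := simple_integral mu (s n) in K3 *.
  set b := simple_integral mu (t n) in K4 *.
  have -> : y - z = (y - a) + (a - b) + (b - z).
    by rewrite !addrA !subrK.
  have := ler_normD (y - a + (a - b)) (b - z).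
  have := ler_normD (y - a) (a - b).
  by rewrite (distrC b z); lra.
have -> : (e%:E = (e/4 + e/4)%:E + (e/4 + e/4)%:E)%E.
  by rewrite -EFinD; congr EFin; lra.
rewrite addeA leeD2r//.
apply: (le_trans Ist); apply: (le_trans T1).
rewrite addeC EFinD addeA; apply: leeD; last exact: ltW.
by apply: (le_trans T2); rewrite leeD2l// ltW.
Unshelve. all: by end_near. Qed.

Lemma is_bochner_integral_exists f : bochner_measurable mu f ->
  (\int[mu]_x (`|f x|)%:E < +oo)%E -> exists y, is_bochner_integral mu f y.
Proof.
move=> mf foo.
have N1 g : bochner_Lnorm mu 1 g = (\int[mu]_x (`|g x|)%:E)%E.
  rewrite /bochner_Lnorm Lnorm1; apply: eq_integral => x _.
  by rewrite /= normr_id.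
have /choice[s sP] n : exists s, bochner_simple mu s /\
    (\int[mu]_x (`|f x - s x|)%:E < (n.+1%:R^-1)%:E)%E.
  have [||s ss sf] :=
    @bochner_simple_dense _ T R mu cmu B 1 f n.+1%:R^-1 (lexx 1) mf.
  - by rewrite N1.
  - by rewrite invr_gt0.
  by exists s; rewrite -N1.
have inv_small (e : R) : 0 < e -> \forall n \near \oo, n.+1%:R^-1 < e.
  by move=> e0; exact: near_infty_natSinv_lt (PosNum e0).
have int_small (e : R) : 0 < e ->
    \forall n \near \oo, (\int[mu]_x (`|f x - s n x|)%:E < e%:E)%E.
  move=> e0; apply: filterS (inv_small _ e0) => n ne.
  by apply: lt_trans (sP n).2 _; rewrite lte_fin.
have /cauchy_cvg/cvg_ex[y Iy] : cauchy (simple_integral mu (s n) @[n --> \oo]).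
  apply: cauchy_exP => e e0.
  have e2 : 0 < e / 2 by rewrite divr_gt0.
  have [N _ NP] := int_small _ e2.
  exists (simple_integral mu (s N)); exists N => // n /= Nn.
  rewrite -ball_normE /= -lte_fin.
  apply: le_lt_trans (simple_integral_dist (sP N).1 (sP n).1) _.
  apply: le_lt_trans (integral_normr_triangle
    (bochner_simple_measurable (sP N).1) mf
    (bochner_simple_measurable (sP n).1)) _.
  rewrite integral_normr_sym (splitr e) EFinD.
  by apply: lteD; apply: NP => /=.
exists y; split => //; exists s; split => //; first by move=> n; exact: (sP n).1.
apply: (@squeeze_cvge _ _ _ _ (fun=> 0%E) _ (fun n => (n.+1%:R^-1)%:E)).
- near=> n; rewrite integral_ge0/=; last by move=> x _; rewrite lee_fin.
  exact: ltW (sP n).2.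
- exact: cvg_cst.
- by apply: cvg_EFin; [exact: nearW|exact: cvg_harmonic].
Unshelve. all: by end_near. Qed.

Lemma bochner_integral_spec (E : set T) f : measurable E ->
  bochner_measurable mu f ->
  (\int[mu]_x (`|patch (fun=> 0) E f x|)%:E < +oo)%E ->
  is_bochner_integral mu (patch (fun=> 0) E f) (bochner_integral mu E f).
Proof.
move=> mE mf foo.
have [y hy] := is_bochner_integral_exists (bochner_measurable_patch mE mf) foo.
exact: (xgetPex 0 (ex_intro [set y | is_bochner_integral mu _ y] _ hy)).
Qed.

Lemma bochner_integral_dist (E : set T) f g : measurable E ->
  bochner_measurable mu f -> bochner_measurable mu g ->
  (\int[mu]_x (`|patch (fun=> 0) E f x|)%:E < +oo)%E ->
  (\int[mu]_x (`|patch (fun=> 0) E g x|)%:E < +oo)%E ->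
  ((`|bochner_integral mu E f - bochner_integral mu E g|)%:E <=
   \int[mu]_x (`|patch (fun=> 0) E (fun x => f x - g x) x|)%:E)%E.
Proof.
move=> mE mf mg foo goo.
apply: le_trans (is_bochner_integral_dist (bochner_integral_spec mE mf foo)
  (bochner_integral_spec mE mg goo)) _.
rewrite le_eqVlt; apply/orP; left; apply/eqP.
by apply: eq_integral => x _; rewrite !patch0E; case: ifP => //; rewrite subr0.
Qed.

Lemma bochner_integral_cst (E : set T) (b : B) : measurable E ->
  (mu E < +oo)%E -> bochner_integral mu E (fun=> b) = fine (mu E) *: b.
Proof.
move=> mE muE; set s := patch (fun=> 0) E (fun=> b).
have ss : bochner_simple mu s by exact: bochner_simple_indic.
have Is : is_bochner_integral mu s (simple_integral mu s).
  split; first exact: bochner_simple_measurable.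
  exists (fun=> s); split => //; last exact: cvg_cst.
  under eq_integral do rewrite subrr normr0.
  by rewrite integral0; exact: cvg_cst.
have Ib : is_bochner_integral mu s (bochner_integral mu E (fun=> b)).
  exact: (xgetPex 0 (ex_intro [set y | is_bochner_integral mu s y] _ Is)).
have := is_bochner_integral_dist Ib Is.
under eq_integral do rewrite subrr normr0.
rewrite integral0 lee_fin normr_le0 subr_eq0 => /eqP ->.
rewrite (_ : s = (fun c : bool => if c then b else 0) \o (fun x => x \in E))//.
have preE c : (fun x => x \in E) @^-1` [set c] = if c then E else ~` E.
  apply/seteqP; split => x /=; case: c; rewrite ?in_setE.
  - by move/set_mem.
  - by move=> xE /mem_set; rewrite xE.
  - by move/mem_set.
  - by move=> xE; apply: memNset.
have fb : finite_set [set: bool] by exact: finite_finset.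
rewrite (@simple_integral_partition bool [set: bool])//.
- rewrite (fsbigD1 true)//= preE fsbig1 ?addr0//.
  by move=> [] [_ /= //] _; rewrite scaler0.
- by move=> c; rewrite preE; case: c => //; exact: measurableC.
- by move=> c; rewrite preE; case: c => //; rewrite eqxx.
Qed.


Variable p : R.
Hypothesis p1 : 1 <= p.

Let p_gt0 : 0 < p. Proof. exact: lt_le_trans p1. Qed.

(** On a set of finite measure the mean of order p controls the mean of
    order 1, because u <= l + l (u / l)^p for every threshold l > 0: either
    u <= l, or u / l >= 1 is at most its p-th power. *)
Lemma integral_patch_le (E : set T) f (l : R) : measurable E ->
  bochner_measurable mu f -> 0 < l ->
  (\int[mu]_x (`|patch (fun=> 0) E f x|)%:E <=
   l%:E * mu E + (l / l `^ p)%:E * \int[mu]_x (`|f x| `^ p)%:E)%E.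
Proof.
move=> mE mf l0; have mnf := bochner_measurable_normr cmu mf.
have ll0 : 0 <= l / l `^ p by rewrite divr_ge0 ?powR_ge0// ltW.
have m1 : measurable_fun setT (fun x => (l%:E * (\1_E x)%:E)%E).
  by apply: measurable_funeM; exact/measurable_EFinP/measurable_indic.
have m2 : measurable_fun setT (fun x => ((l / l `^ p)%:E * (`|f x| `^ p)%:E)%E).
  by apply: measurable_funeM; exact: (measurable_EFin_powR p mnf).
apply: (@le_trans _ _ (\int[mu]_x (l%:E * (\1_E x)%:E +
    (l / l `^ p)%:E * (`|f x| `^ p)%:E))%E).
  apply: ge0_le_integral => //.
  - apply/measurable_EFinP; apply: (bochner_measurable_normr cmu).
    exact: bochner_measurable_patch.
  - exact: emeasurable_funD.
  - move=> x _; rewrite -!EFinM -EFinD lee_fin patch0E indicE.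
    case: ifPn => [xE|_]; last first.
      by rewrite normr0 mulr0 add0r mulr_ge0// powR_ge0.
    rewrite mulr1; set u := `|f x|; have u0 : 0 <= u by exact: normr_ge0.
    have [ul|lu] := leP u l; first by rewrite ler_wpDr// mulr_ge0// powR_ge0.
    apply: (ler_wpDl (ltW l0)).
    have lp0 : l `^ p != 0 by rewrite gt_eqF// powR_gt0.
    have lV : l^-1 `^ p = (l `^ p)^-1.
      apply: (mulIf lp0); rewrite mulVf// -powRM ?invr_ge0 ?(ltW l0)//.
      by rewrite mulVf ?gt_eqF// powR1.
    have -> : l / l `^ p * u `^ p = l * (u / l) `^ p.
      rewrite powRM ?invr_ge0 ?(ltW l0)// lV -!mulrA; congr (_ * _).
      by rewrite mulrC.
    rewrite -ler_pdivrMl// mulrC le1r_powR// ler_pdivlMr// mul1r.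
    exact: ltW.
rewrite ge0_integralD//; last 2 first.
- by move=> x _; rewrite mule_ge0// lee_fin// ltW.
- by move=> x _; rewrite mule_ge0// lee_fin powR_ge0.
rewrite ge0_integralZl_EFin ?(ltW l0)//; last first.
  exact/measurable_EFinP/measurable_indic.
rewrite integral_indic// setIT ge0_integralZl_EFin//.
exact: (measurable_EFin_powR p mnf).
Qed.

Lemma integral_patch_lty (E : set T) f : measurable E -> (mu E < +oo)%E ->
  bochner_measurable mu f -> (bochner_Lnorm mu p f < +oo)%E ->
  (\int[mu]_x (`|patch (fun=> 0) E f x|)%:E < +oo)%E.
Proof.
move=> mE muE mf; rewrite bochner_Lnorm_lty// => foo.
apply: le_lt_trans (integral_patch_le mE mf ltr01) _.
by rewrite lte_add_pinfty// lte_mul_pinfty// lee_fin divr_ge0 ?powR_ge0.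
Qed.

Lemma integral_patch_small (E : set T) (e : R) : measurable E ->
  (mu E < +oo)%E -> 0 < e -> exists2 delta : R, 0 < delta &
  forall f, bochner_measurable mu f -> (bochner_Lnorm mu p f < delta%:E)%E ->
    (\int[mu]_x (`|patch (fun=> 0) E f x|)%:E < e%:E)%E.
Proof.
move=> mE muE e0.
pose m := fine (mu E); have m0 : 0 <= m by rewrite fine_ge0.
(* The threshold makes l * mu E at most e / 2; the bound on the norm then
   makes the other term of the estimate less than e / 2. *)
pose l := e / 2 / (m + 1).
have l0 : 0 < l by rewrite divr_gt0 ?divr_gt0// ltr_wpDl.
pose c := l / l `^ p; have c0 : 0 < c by rewrite divr_gt0 ?powR_gt0.
have q0 : 0 < e / 2 / c by apply: divr_gt0 => //; exact: divr_gt0.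
exists ((e / 2 / c) `^ p^-1); first by rewrite powR_gt0.
move=> f mf; rewrite bochner_Lnorm_lt ?powR_ge0// => fd.
apply: le_lt_trans (integral_patch_le mE mf l0) _.
rewrite (splitr e) EFinD lee_ltD//.
- by rewrite fin_numM// ge0_fin_numE.
- rewrite -(@fineK _ (mu E)) ?ge0_fin_numE// -EFinM lee_fin -/m /l.
  rewrite mulrAC ler_pdivrMr ?ltr_wpDl// ler_pM2l ?divr_gt0//.
  by rewrite lerDl.
- rewrite -/c muleC -lte_pdivlMr// -EFinM; move: fd.
  by rewrite -powRrM mulVf ?gt_eqF// powRr1// ltW.
Qed.

End bochner_integral_theory.

Section simple_integrability.
Context dsp (T : measurableType dsp) (R : realType).
Variable mu : {measure set T -> \bar R}.
Variable B : completeNormedModType R.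

Lemma bochner_simple_integrable (s : T -> B) : bochner_simple mu s ->
  (\int[mu]_x (`|s x|)%:E < +oo)%E.
Proof.
move=> [fs ms mus].
have srange x : range s (s x) by exists x.
rewrite (integral_normr_partition mu id fs srange ms) fsbig_finite//=.
rewrite lte_sum_pinfty// => b _; have [->|b0] := eqVneq b 0.
  by rewrite normr0 mul0e ltry.
by rewrite lte_mul_pinfty ?mus// lee_fin.
Qed.

Lemma bochner_integral_patch (E : set T) (f : T -> B) :
  bochner_integral mu E (patch (fun=> 0) E f) = bochner_integral mu E f.
Proof.
rewrite /bochner_integral.
have -> // : patch (fun=> 0) E (patch (fun=> 0) E f) = patch (fun=> 0) E f.
by apply/funext => x; rewrite !patch0E; case: (x \in E).
Qed.

End simple_integrability.

(** * Lebesgue measure on R^d: translations and boxes *)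

Section translation_invariance.
Variable R : realType.

Lemma measurable_shift (a : R) :
  measurable_fun setT ((fun x => x + a) : measurableTypeR R -> measurableTypeR R).
Proof.
by apply: (@measurable_funD _ (measurableTypeR R) R setT id (cst a)).
Qed.

Section shift_mfun.
Variable a : R.
Let shift (x : measurableTypeR R) : measurableTypeR R := x + a.

HB.instance Definition _ :=
  @isMeasurableFun.Build _ _ (measurableTypeR R) (measurableTypeR R)
    shift (measurable_shift a).

Lemma lebesgue_measure_shift (A : set (measurableTypeR R)) :
  measurable A ->
  lebesgue_measure ((fun x : R => x + a) @^-1` A) = lebesgue_measure A.
Proof.
move=> mA; rewrite -[LHS]/(pushforward lebesgue_measure shift A).
apply/esym/lebesgue_measure_unique => //= _ [[b c]] _ <-.
rewrite /pushforward (_ : _ @^-1` _ = `](b - a), (c - a)]%classic).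
  by rewrite !lebesgue_measure_itv/= !lte_fin ltrD2r -!EFinB opprB addrA subrK.
by apply/seteqP; split => x /=; rewrite /shift !in_itv/= ltrBlDr lerBrDr.
Qed.

End shift_mfun.

(** The induction on the dimension goes through sections: the sections of a
    translate are translates of sections, at a translated abscissa. *)
Lemma borel_lebesgue_shift d (h : 'rV[R]_d) (A : set (borelRn R d)) :
  measurable A ->
  borel_lebesgue R d ((fun x : borelRn R d => (x + h)%R) @^-1` A) =
  borel_lebesgue R d A.
Proof.
elim: d => [|d IH] in h A *.
  move=> mA; congr (borel_lebesgue R 0 _); apply/seteqP.
  by split => x /=; rewrite (_ : x + h = x)//; apply/rowP => -[].
move=> mA; rewrite /= /product_step /pushforward.
pose C : set (measurableTypeR R * borelRn R d) := @consRn R d @^-1` A.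
have mC : measurable C by rewrite -[C]setTI; exact: measurable_consRn.
pose a := h ord0 ord0; pose h' : 'rV[R]_d := \row_i h ord0 (lift ord0 i).
pose phi (x : measurableTypeR R) := borel_lebesgue R d (xsection C x).
have mphi : measurable_fun setT phi by exact: measurable_fun_xsection.
rewrite /product_measure1 /=.
pose sh (x : measurableTypeR R) : measurableTypeR R := x + a.
transitivity (\int[lebesgue_measure]_x phi (sh x))%E.
  apply: eq_integral => x _.
  have mx : measurable (xsection C (sh x)) by exact: measurable_xsection.
  rewrite /phi -(IH h' _ mx).
  congr (borel_lebesgue R d _); rewrite !xsectionE; apply/seteqP.
  have E y : consRn (x, y) + h = consRn (x + a, y + h').
    apply/rowP => i; rewrite !mxE.
    by case: (unliftP ord0 i) => [j ->|->]; rewrite ?liftK ?unlift_none /= ?mxE.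
  by split => y /=; rewrite /C /= E.
transitivity (\int[pushforward lebesgue_measure sh]_x phi x)%E.
  rewrite ge0_integral_pushforward//; exact: measurable_shift.
apply: eq_measure_integral => [|? B mB _]; first exact: measurable_shift.
exact: (lebesgue_measure_shift a mB).
Qed.

Lemma measurable_borel_shift d (h : 'rV[R]_d) :
  measurable_fun setT ((fun x => x + h) : borelRn R d -> borelRn R d).
Proof.
apply: measurable_funRnP => i.
rewrite (_ : _ \o _ =
    (fun x : measurableTypeR R => x + h ord0 i) \o @coordRn R d i).
  by apply: measurableT_comp; [exact: measurable_shift|exact: measurable_coordRn].
by apply/funext => x; rewrite /= /coordRn mxE.
Qed.

(** Translations map covers by Borel sets to such covers of the same total
    measure, which passes the invariance to the outer measure. *)
Lemma lebesgueRn_shift d (h : Rn R d) (A : set (Rn R d)) :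
  lebesgueRn ((fun x => x + h) @^-1` A) = lebesgueRn A.
Proof.
have le (k : Rn R d) (C : set (Rn R d)) :
    (lebesgueRn ((fun x => (x + k)%R) @^-1` C) <= lebesgueRn C)%E.
  apply: le_ereal_inf_tmp => _ [/= F [mF CF] <-]; apply: ereal_inf_lbound.
  have mFk n : measurable ((fun x : borelRn R d => x + k) @^-1` F n).
    by rewrite -[X in measurable X]setTI; apply: measurable_borel_shift.
  exists (fun n => (fun x : borelRn R d => x + k) @^-1` F n).
    by split => //= x /CF [n _ Fn]; exists n.
  by apply: eq_eseriesr => n _; exact: borel_lebesgue_shift.
apply/eqP; rewrite eq_le le /=.
rewrite [leLHS](_ : _ =
  lebesgueRn ((fun x => x + (- h)) @^-1` ((fun x => x + h) @^-1` A)))//.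
congr lebesgueRn; apply/seteqP.
by split => x /=; rewrite subrK.
Qed.

Lemma measurable_Rn_preimage_shift d (h : Rn R d) (A : set (Rn R d)) :
  measurable A -> measurable ((fun x => x + h) @^-1` A).
Proof.
pose mu0 : set (Rn R d) -> \bar R := (borel_lebesgue R d)^*%mu.
move=> mA.
have mA' X : mu0 X = (mu0 (X `&` A) + mu0 (X `&` ~` A))%E by exact: mA.
suff H X : mu0 X = (mu0 (X `&` (fun x => (x + h)%R) @^-1` A) +
                    mu0 (X `&` ~` ((fun x => (x + h)%R) @^-1` A)))%E by exact: H.
have AE (Y : set (Rn R d)) : mu0 Y = mu0 ((fun x => x + (- h)) @^-1` Y).
  exact/esym/(lebesgueRn_shift (- h) Y).
rewrite AE (mA' ((fun x => x + (- h)) @^-1` X)).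
rewrite (AE (X `&` _)) (AE (X `&` ~` _)).
by congr (mu0 _ + mu0 _)%E; apply/seteqP; split => x /=; rewrite subrK.
Qed.

Lemma measurable_Rn_shift d (h : Rn R d) :
  measurable_fun setT ((fun x => x + h) : Rn R d -> Rn R d).
Proof. by move=> _ A mA; rewrite setTI; exact: measurable_Rn_preimage_shift. Qed.

Lemma lebesgueRn_complete d : measure_is_complete (@lebesgueRn R d).
Proof. exact: measure_is_complete_caratheodory. Qed.

Lemma measurable_Rn_borel d (A : set (borelRn R d)) :
  measurable A -> measurable (A : set (Rn R d)).
Proof. by move=> mA; exact: caratheodory_measurable_mu_ext. Qed.

Lemma lebesgueRn_borel d (A : set (borelRn R d)) :
  measurable A -> lebesgueRn (A : set (Rn R d)) = borel_lebesgue R d A.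
Proof. by move=> mA; exact: measurable_mu_extE. Qed.

Lemma ge0_integral_shift d (h : Rn R d) (u : Rn R d -> \bar R) :
  measurable_fun setT u -> (forall x, (0 <= u x)%E) ->
  (\int[@lebesgueRn R d]_x u (x + h)%R = \int[@lebesgueRn R d]_x u x)%E.
Proof.
move=> mu u0; transitivity (\int[pushforward (@lebesgueRn R d)
    ((fun x => (x + h)%R) : Rn R d -> Rn R d)]_x u x)%E.
  by rewrite ge0_integral_pushforward//; exact: measurable_Rn_shift.
apply: eq_measure_integral => [|? A mA _]; first exact: measurable_Rn_shift.
exact: (lebesgueRn_shift h A).
Qed.

Lemma borel_lebesgue_product d (A : 'I_d -> set (measurableTypeR R)) :
  (forall i, measurable (A i)) ->
  measurable [set x : borelRn R d | forall i, A i (x ord0 i)] /\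
  borel_lebesgue R d [set x : borelRn R d | forall i, A i (x ord0 i)] =
  (\prod_(i < d) lebesgue_measure (A i))%E.
Proof.
have mprod k (C : 'I_k -> set (measurableTypeR R)) :
    (forall i, measurable (C i)) ->
    measurable [set x : borelRn R k | forall i, C i (x ord0 i)].
  move=> mC; rewrite [X in measurable X](_ : _ =
      \bigcap_(i in [set: 'I_k]) (@coordRn R k i @^-1` C i)).
    apply: fin_bigcap_measurable => // i _; rewrite -[X in measurable X]setTI.
    exact: measurable_coordRn.
  by apply/seteqP; split => x /= H i; [move=> _|]; exact: H.
move=> mA; split; first exact: mprod.
elim: d => [|d IH] in A mA *.
  by rewrite big_ord0 /= /dirac indicE mem_set//= => -[].
rewrite big_ord_recl /= /product_step /pushforward.
transitivity ((@lebesgue_measure R \x borel_lebesgue R d)%E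
  (A ord0 `*` [set x : borelRn R d | forall i, A (lift ord0 i) (x ord0 i)])).
  congr (product_measure1 _ _ _).
  apply/seteqP; split => [[u x] /= H|[u x] /= [H1 H2] i].
  - split=> [|i]; first by have := H ord0; rewrite mxE unlift_none.
    by have := H (lift ord0 i); rewrite !mxE liftK.
  - rewrite mxE; case: (unliftP ord0 i) => [j ->|->] //=.
rewrite product_measure1E//.
  by congr (_ * _)%E; exact: (IH (fun i => A (lift ord0 i))).
exact: (mprod d (fun i => A (lift ord0 i))).
Qed.

End translation_invariance.

(** * Grids of cubes *)

Section grid.
Variables (R : realType) (d : nat).
Implicit Types (x : Rn R d) (z : 'rV[int]_d).

(** Points with the same grid index at scale n form a half-open cube of side
    1 / n. Reading the partition into cubes off a map to integer vectors makes
    refinement, translation and restriction to large cubes computations with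
    integer parts. *)
Definition grid_index (n : nat) x : 'rV[int]_d :=
  \row_i Num.floor (n%:R * x ord0 i).

Definition grid_cell (n : nat) z : set (Rn R d) := grid_index n @^-1` [set z].

Definition half_open_cube (L : nat) : set (Rn R d) :=
  [set x | forall i, - L%:R <= x ord0 i < L%:R].

Definition index_cube (N : nat) : set 'rV[int]_d :=
  [set z | forall i, - N%:Z <= z ord0 i < N%:Z].

Lemma floor_natmul (m : nat) (u : R) : (0 < m)%N ->
  Num.floor u = (Num.floor (m%:R * u) %/ m%:Z)%Z.
Proof.
move=> m0; apply: floor_def; set w := Num.floor _; set q := (w %/ _)%Z.
have m0R : 0 < m%:R :> R by rewrite ltr0n.
have /andP[wl wu] : w%:~R <= m%:R * u < (w + 1)%:~R by exact: floor_itv.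
have wE : w = q * m%:Z + (w %% m%:Z)%Z by exact: divz_eq.
have r0 : 0 <= (w %% m%:Z)%Z by rewrite modz_ge0// -lt0n.
have rm : (w %% m%:Z)%Z < m%:Z by rewrite ltz_pmod.
have qw : q * m%:Z <= w by rewrite wE lerDl.
have wq : w + 1 <= (q + 1) * m%:Z by rewrite lezD1 wE mulrDl mul1r ltrD2l.
apply/andP; split.
- rewrite -(ler_pM2l m0R) (le_trans _ wl)//.
  by move: qw; rewrite -(ler_int R) intrM mulrC.
- rewrite -(ltr_pM2l m0R) (lt_le_trans wu)//.
  by move: wq; rewrite -(ler_int R) intrM mulrC.
Qed.

Lemma grid_index_refine (n m : nat) x : (0 < m)%N ->
  grid_index n x = \row_i ((grid_index (m * n) x ord0 i) %/ m%:Z)%Z.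
Proof.
by move=> m0; apply/rowP => i; rewrite !mxE natrM -mulrA -floor_natmul.
Qed.

Lemma grid_index_shift (n : nat) (k : 'rV[int]_d) x : (0 < n)%N ->
  grid_index n (x + \row_i ((k ord0 i)%:~R / n%:R)) = grid_index n x + k.
Proof.
move=> n0; apply/rowP => i.
rewrite !mxE mulrDr mulrCA divff ?mulr1 ?pnatr_eq0 -?lt0n//.
by rewrite floorDrz ?intr_int// intrKfloor.
Qed.

Lemma half_open_cubeE (n L : nat) : (0 < n)%N ->
  half_open_cube L = grid_index n @^-1` index_cube (n * L).
Proof.
move=> n0; have n0R : 0 < n%:R :> R by rewrite ltr0n.
have E1 : ((n * L)%N%:Z)%:~R = n%:R * L%:R :> R by rewrite -natrM pmulrn.
have E2 : (- (n * L)%N%:Z)%:~R = n%:R * (- L%:R) :> R.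
  by rewrite mulrNz E1 mulrN.
apply/seteqP; split => x /= H i; have := H i; rewrite ?mxE.
- by rewrite floor_ge_int floor_lt_int E1 E2 ler_pM2l// ltr_pM2l.
- by rewrite floor_ge_int floor_lt_int E1 E2 ler_pM2l// ltr_pM2l.
Qed.

Lemma half_open_cube_le (L M : nat) : (L <= M)%N ->
  half_open_cube L `<=` half_open_cube M.
Proof.
move=> LM x H i; have /andP[h1 h2] := H i.
have LM' : L%:R <= M%:R :> R by rewrite ler_nat.
by apply/andP; split; lra.
Qed.

Lemma finite_index_cube N : finite_set (index_cube N).
Proof.
pose f (k : {ffun 'I_d -> 'I_(N + N)}) : 'rV[int]_d := \row_i ((k i)%:Z - N%:Z).
have fT : finite_set [set: {ffun 'I_d -> 'I_(N + N)}] by exact: finite_finset.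
apply: sub_finite_set (finite_image f fT) => z H /=.
have kP i : (`|(z ord0 i + N%:Z)%R|%N < N + N)%N by have := H i; lia.
exists [ffun i => Ordinal (kP i)] => //.
apply/rowP => i; rewrite !mxE ffunE /= gez0_abs ?addrK//.
by have := H i; lia.
Qed.

Definition cell_side (n : nat) (k : int) : set (measurableTypeR R) :=
  `[(k%:~R / n%:R), ((k + 1)%:~R / n%:R)[%classic.

Lemma grid_cellE n z : (0 < n)%N ->
  grid_cell n z = [set x | forall i, cell_side n (z ord0 i) (x ord0 i)].
Proof.
move=> n0; have n0R : 0 < n%:R :> R by rewrite ltr0n.
apply/seteqP; split => x /=.
- move=> <- i; rewrite mxE /cell_side /= in_itv/= ler_pdivrMr// ltr_pdivlMr//.
  rewrite ![_ * n%:R]mulrC.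
  exact: floor_itv.
- move=> H; apply/rowP => i; rewrite mxE; apply: floor_def.
  have := H i; rewrite /cell_side /= in_itv/= ler_pdivrMr// ltr_pdivlMr//.
  by rewrite ![_ * n%:R]mulrC.
Qed.

Lemma measurable_borel_grid_cell n z : (0 < n)%N ->
  measurable (grid_cell n z : set (borelRn R d)).
Proof.
move=> n0; rewrite grid_cellE//.
by have [] := @borel_lebesgue_product R d (fun i => cell_side n (z ord0 i))
  (fun=> measurable_itv _).
Qed.

Lemma lebesgueRn_grid_cell n z : (0 < n)%N ->
  lebesgueRn (grid_cell n z) = (n%:R^-1 ^+ d)%:E.
Proof.
move=> n0; have n0R : 0 < n%:R :> R by rewrite ltr0n.
rewrite lebesgueRn_borel; last exact: measurable_borel_grid_cell.
rewrite grid_cellE//.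
have [_ ->] := @borel_lebesgue_product R d (fun i => cell_side n (z ord0 i))
  (fun=> measurable_itv _).
transitivity (\prod_(i < d) (n%:R^-1 : R)%:E)%E; last first.
  by rewrite prodEFin prodr_const card_ord.
apply: eq_bigr => i _; rewrite /cell_side lebesgue_measure_itv/= lte_fin.
rewrite ltr_pM2r ?invr_gt0// ltr_int ltrDl ltr01 -EFinB -mulrBl -intrB.
by rewrite addrAC subrr add0r mul1r.
Qed.

Lemma measurable_borel_grid n (Z : set 'rV[int]_d) : (0 < n)%N ->
  measurable (grid_index n @^-1` Z : set (borelRn R d)).
Proof.
move=> n0; rewrite [X in measurable X](_ : _ = \bigcup_(z in Z) grid_cell n z).
  rewrite bigcup_mkcond; apply: countable_bigcupT_measurable => // z.
  by case: ifP => // _; exact: measurable_borel_grid_cell.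
apply/seteqP; split => [x Zx|x [z Zz /= xz]] /=; last by rewrite xz.
by exists (grid_index n x).
Qed.

Lemma measurable_grid n (Z : set 'rV[int]_d) : (0 < n)%N ->
  measurable (grid_index n @^-1` Z).
Proof.
by move=> n0; apply: measurable_Rn_borel; exact: measurable_borel_grid.
Qed.

Lemma measurable_half_open_cube L : measurable (half_open_cube L).
Proof. by rewrite (@half_open_cubeE 1)//; exact: measurable_grid. Qed.

Lemma lebesgueRn_half_open_cube_lty L : (lebesgueRn (half_open_cube L) < +oo)%E.
Proof.
have fz : finite_set (index_cube (1 * L)) by exact: finite_index_cube.
apply: (@le_lt_trans _ _
    (\sum_(z \in index_cube (1 * L)) lebesgueRn (grid_cell 1 z))%E).
  apply: content_sub_fsum => //.
  - by move=> z _; exact: measurable_grid.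
  - exact: measurable_half_open_cube.
  - rewrite (@half_open_cubeE 1)// => x Zx; exists (grid_index 1 x) => //.
rewrite fsbig_finite//= lte_sum_pinfty// => z _.
by rewrite lebesgueRn_grid_cell// ltry.
Qed.

(** Slabs catch the points whose grid cell straddles, or changes near, a
    hyperplane; their measure is proportional to the thickness t. *)
Definition slab (L : nat) (i : 'I_d) (a t : R) : set (Rn R d) :=
  [set x | (forall j, `|x ord0 j| <= L%:R) /\ `|x ord0 i - a| <= t].

Lemma slab_measure (L : nat) i a t : 0 <= t ->
  measurable (slab L i a t) /\
  (lebesgueRn (slab L i a t) <= (2 * t * (2 * L%:R) ^+ d.-1)%:E)%E.
Proof.
move=> t0.
pose A (j : 'I_d) : set (measurableTypeR R) :=
  if j == i then `[- L%:R, L%:R]%classic `&` `[(a - t), (a + t)]%classic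
  else `[- L%:R, L%:R]%classic.
have mA j : measurable (A j).
  by rewrite /A; case: ifP => // _; exact: measurableI.
have AE : slab L i a t = [set x | forall j, A j (x ord0 j)].
  apply/seteqP; split => x /=.
  - move=> [H1 H2] j; rewrite /A; case: eqP => [->|_] /=;
      rewrite !in_itv/= -?ler_norml//.
    by split; rewrite ?H1// -ler_distl.
  - move=> H; split => [j|].
      have := H j; rewrite /A; case: ifP => _ /=; rewrite !in_itv/= -?ler_norml//.
      by case.
    by have := H i; rewrite /A eqxx/= !in_itv/= => -[_]; rewrite ler_distl.
have [mS muS] := borel_lebesgue_product mA.
split; first by rewrite AE; exact: measurable_Rn_borel.
rewrite AE lebesgueRn_borel// muS (bigD1 i)//=.
rewrite (eq_bigr (fun=> (2 * L%:R : R)%:E)); last first.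
  move=> j ji; rewrite /A (negbTE ji) lebesgue_measure_itv/= lte_fin.
  case: ltP => h; first by rewrite -EFinD opprK; congr EFin; lra.
  by congr EFin; have : 0 <= L%:R :> R by []; lra.
rewrite prodEFin prodr_const cardC1 card_ord EFinM lee_wpmul2r//.
rewrite /A eqxx; apply: (@le_trans _ _
  (lebesgue_measure (`[(a - t), (a + t)]%classic : set R))).
  by apply: le_measure; rewrite ?inE//; exact: measurableI.
rewrite lebesgue_measure_itv/=; case: ifPn => _; last by rewrite lee_fin mulr_ge0.
by rewrite lee_fin; lra.
Qed.

End grid.

(** * Approximation of Borel sets by unions of cubes *)

Section grid_approximation.
Variables (R : realType) (d : nat).
Local Notation leb := (@lebesgueRn R d).
Implicit Types A : set (Rn R d).

Lemma lebesgueRn_le A B : A `<=` B -> (leb A <= leb B)%E.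
Proof. exact: (@le_mu_ext _ (borelRn R d) R (borel_lebesgue R d)). Qed.

Lemma lebesgueRn_U2 A B : (leb (A `|` B) <= leb A + leb B)%E.
Proof. exact: (outer_measureU2 ((borel_lebesgue R d)^*%mu)). Qed.

Definition coarsen (m : nat) (z : 'rV[int]_d) : 'rV[int]_d :=
  \row_i (z ord0 i %/ m%:Z)%Z.

Lemma grid_index_coarsen (n m : nat) (x : Rn R d) : (0 < m)%N ->
  grid_index n x = coarsen m (grid_index (n * m) x).
Proof.
move=> m0; rewrite mulnC (grid_index_refine n x m0).
by apply/rowP => i; rewrite !mxE.
Qed.

(** The set of points where the memberships disagree is the symmetric
    difference. As the measure is defined on all sets, by the outer measure,
    the approximation can be handled by monotonicity and subadditivity. *)
Definition grid_approximable (L : nat) A := forall e : R, 0 < e ->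
  exists2 n, (0 < n)%N & exists Z : set 'rV[int]_d,
    (leb (half_open_cube L `&`
      [set x | ~ (A x <-> Z (grid_index n x))]) < e%:E)%E.

Lemma grid_approximable0 L : grid_approximable L set0.
Proof.
move=> e e0; exists 1%N => //; exists set0.
rewrite [X in leb X](_ : _ = set0) ?measure0 ?lte_fin//.
by apply/seteqP; split => x //= [_]; apply.
Qed.

Lemma grid_approximableC L A :
  grid_approximable L A -> grid_approximable L (~` A).
Proof.
move=> aA e e0; have [n n0 [Z ZA]] := aA e e0; exists n => //; exists (~` Z).
apply: le_lt_trans ZA; apply: lebesgueRn_le => x /= [Kx H]; split => //.
by move=> AZ; apply: H; rewrite AZ.
Qed.

Lemma grid_approximableU L A B : grid_approximable L A ->
  grid_approximable L B -> grid_approximable L (A `|` B).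
Proof.
move=> aA aB e e0; have e2 : 0 < e / 2 by rewrite divr_gt0.
have [n n0 [Z ZA]] := aA _ e2; have [m m0 [W WB]] := aB _ e2.
exists (n * m)%N; first by rewrite muln_gt0 n0.
exists [set z | Z (coarsen m z) \/ W (coarsen n z)].
rewrite (splitr e) EFinD.
apply: le_lt_trans (lteD ZA WB).
apply: le_trans (lebesgueRn_U2 _ _); apply: lebesgueRn_le => x /= [Kx H].
rewrite -grid_index_coarsen// in H; rewrite mulnC -grid_index_coarsen// in H.
have [ZAx|ZAx] := pselect (A x <-> Z (grid_index n x)); last by left.
right; split => // WBx; apply: H; rewrite ZAx WBx; tauto.
Qed.

Lemma grid_approximable_limit L A : (forall e : R, 0 < e ->
    exists2 B, grid_approximable L B &
      (leb (half_open_cube L `&` [set x | ~ (A x <-> B x)]) < e%:E)%E) ->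
  grid_approximable L A.
Proof.
move=> H e e0; have e2 : 0 < e / 2 by rewrite divr_gt0.
have [B aB AB] := H _ e2; have [n n0 [Z ZB]] := aB _ e2.
exists n => //; exists Z; rewrite (splitr e) EFinD.
apply: le_lt_trans (lteD AB ZB).
apply: le_trans (lebesgueRn_U2 _ _); apply: lebesgueRn_le => x /= [Kx Hx].
have [ABx|ABx] := pselect (A x <-> B x); last by left.
by right; split => // BZx; apply: Hx; rewrite ABx BZx.
Qed.

Lemma lebesgueRn_tail (F : (set (Rn R d))^nat) (e : R) :
  (forall n, measurable (F n)) -> (leb (F 0%N) < +oo)%E ->
  (forall n, F n.+1 `<=` F n) -> \bigcap_n F n = set0 -> 0 < e ->
  exists n, (leb (F n) < e%:E)%E.
Proof.
move=> mF F0 dF F00 e0.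
have : (leb \o F) x @[x --> \oo] --> leb (\bigcap_n F n).
  apply: nonincreasing_cvg_mu => //; first by rewrite F00.
  apply/nonincreasing_seqP => n; exact/subsetPset.
rewrite F00 measure0 => cv; have e0' : (0 < e%:E)%E by rewrite lte_fin.
by have [n _ /(_ n (leqnn n)) /= ?] := cvge_lt cv e0'; exists n.
Qed.

(** The finite partial unions are approximable, and inside a cube of finite
    measure they exhaust the union up to a small remainder. *)
Lemma grid_approximable_bigcup L (F : (set (Rn R d))^nat) :
  (forall i, measurable (F i)) -> (forall i, grid_approximable L (F i)) ->
  grid_approximable L (\bigcup_i F i).
Proof.
move=> mF aF; apply: grid_approximable_limit => e e0.
pose G n := \big[setU/set0]_(i < n) F i.
have mG n : measurable (G n) by exact: bigsetU_measurable.
have aG n : grid_approximable L (G n).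
  rewrite /G; elim: n => [|n IH].
    by rewrite big_ord0; exact: grid_approximable0.
  by rewrite big_ord_recr; exact: grid_approximableU.
pose T n := half_open_cube L `&` (\bigcup_i F i `\` G n).
have mT n : measurable (T n).
  apply: measurableI; first exact: measurable_half_open_cube.
  by apply: measurableD => //; exact: bigcup_measurable.
have [|||n Tn] := @lebesgueRn_tail T e mT _ _ _ e0.
- apply: le_lt_trans (lebesgueRn_half_open_cube_lty R d L).
  by apply: lebesgueRn_le => x [].
- move=> n x [Kx [Ux Gx]]; split => //; split => // Gnx; apply: Gx.
  by rewrite /G big_ord_recr; left.
- rewrite -subset0 => x Tx; have [Kx [[i _ Fix] _]] := Tx 0%N I.
  have [_ [_]] := Tx i.+1 I; apply.
  by rewrite /G big_ord_recr; right.
exists (G n) => //; apply: le_lt_trans Tn; apply: lebesgueRn_le => x [Kx Hx].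
split => //; have [Gx|Gx] := pselect (G n x).
  exfalso; apply: Hx; split => // _.
  by have := Gx; rewrite /G -bigcup_mkord => -[i _ Fi]; exists i.
split => //; apply: contrapT => Ux; apply: Hx; split => //.
Qed.

(** The coordinate of a point and its rounding to the grid differ by less than
    1 / n, so that a point on which a slice and its rounding disagree has its
    coordinate that close to one of the two bounds. *)
Lemma grid_approximable_coord_itv L (i : 'I_d) (a b : R) :
  grid_approximable L [set x | a < x ord0 i <= b].
Proof.
move=> e e0.
pose C : R := (2 * L%:R) ^+ d.-1 * 4 + 1.
have C0 : 0 < C by rewrite ltr_wpDl// mulr_ge0// exprn_ge0// mulr_ge0.
have eC0 : 0 < e / C by rewrite divr_gt0.
have [n _ /(_ n (leqnn n)) /= nt] := near_infty_natSinv_lt (PosNum eC0).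
set t : R := n.+1%:R^-1 in nt; have t0 : 0 < t by rewrite invr_gt0.
exists n.+1 => //; exists [set z | a < (z ord0 i)%:~R / n.+1%:R <= b].
apply: (@le_lt_trans _ _ (leb (slab L i a t `|` slab L i b t))).
  apply: lebesgueRn_le => x /= [Kx Hx].
  have xL j : `|x ord0 j| <= L%:R.
    by have /andP[h1 h2] := Kx j; rewrite ler_norml h1 ltW.
  have : `|x ord0 i - a| <= t \/ `|x ord0 i - b| <= t; last first.
    by move=> [?|?]; [left|right].
  move: Hx; rewrite mxE; set w := Num.floor _.
  have /andP[wl wu] : w%:~R <= n.+1%:R * x ord0 i < (w + 1)%:~R.
    exact: floor_itv.
  set y := w%:~R / n.+1%:R.
  have yx : y <= x ord0 i by rewrite ler_pdivrMr// mulrC.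
  have xy : x ord0 i < y + t.
    rewrite /y /t -[X in _ + X]mul1r -mulrDl ltr_pdivlMr// mulrC.
    by move: wu; rewrite intrD.
  move=> Hx; have [|xa] := leP `|x ord0 i - a| t; first by left.
  have [|xb] := leP `|x ord0 i - b| t; first by right.
  exfalso; apply: Hx; move: xa xb; rewrite !ltr_normr => /orP[xa|xa] /orP[xb|xb].
  - by split => /andP[? ?]; apply/andP; split; lra.
  - by split => /andP[? ?]; apply/andP; split; lra.
  - by split => /andP[? ?]; apply/andP; split; lra.
  - by split => /andP[? ?]; apply/andP; split; lra.
apply: le_lt_trans (lebesgueRn_U2 _ _) _.
have [_ s1] := slab_measure L i a (ltW t0).
have [_ s2] := slab_measure L i b (ltW t0).
apply: le_lt_trans (leeD s1 s2) _; rewrite -EFinD lte_fin.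
move: nt; rewrite ltr_pdivlMr//= /C; lra.
Qed.

(** The sets that can be approximated form a sigma-algebra, which contains the
    slices that generate the Borel sets. Measurability is carried along since
    countable unions need it for continuity from above. *)
Lemma borel_grid_approximable L (A : set (borelRn R d)) :
  measurable A -> measurable (A : set (Rn R d)) /\ grid_approximable L A.
Proof.
have sub_alg (X : Type) (f : Rn R d -> X) :
    sigma_algebra setT [set B : set X | measurable (f @^-1` B) /\
      grid_approximable L (f @^-1` B)].
  split => [|B [mB aB]|F mF] /=.
  - by rewrite preimage_set0; split => //; exact: grid_approximable0.
  - by rewrite setTD preimage_setC; split;
      [exact: measurableC|exact: grid_approximableC].
  - rewrite preimage_bigcup; split.
      by apply: bigcup_measurable => k _; have [] := mF k.
    by apply: grid_approximable_bigcup => k; have [] := mF k.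
move: A; apply: smallest_sub; first exact: (sub_alg _ id).
rewrite -bigcup_seq => _ [i _] [B mB <-] /=.
rewrite setTI.
suff : measurable `<=` [set B : set (measurableTypeR R) |
    measurable ((@coordRn R d i @^-1` B) : set (Rn R d)) /\
    grid_approximable L (@coordRn R d i @^-1` B)] by apply.
apply: smallest_sub; first exact: (sub_alg _ (@coordRn R d i)).
move=> _ [[a b] _ <-] /=; split.
  apply: measurable_Rn_borel; rewrite -[X in measurable X]setTI.
  by apply: measurable_coordRn => //; exact: measurable_itv.
have E : [set x : Rn R d | a < x ord0 i <= b] =
    (@coordRn R d i @^-1` `]a, b]%classic : set (Rn R d)).
  by apply/seteqP; split => x /=; rewrite in_itv.
exact: (eq_ind _ (grid_approximable L) (grid_approximable_coord_itv L i a b) _ E).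
Qed.

End grid_approximation.

(** * Density of grid step functions *)

Section grid_steps.
Variables (R : realType) (d : nat).
Local Notation leb := (@lebesgueRn R d).

(** By definition of the outer measure E has a Borel cover G of nearly the same
    measure; a large cube contains all of G but a small part, and inside the
    cube G is approximated by a union of cells. Cutting the union down to the
    cube leaves finitely many cells. *)
Lemma measurable_grid_approx (E : set (Rn R d)) (e : R) :
  measurable E -> (leb E < +oo)%E -> 0 < e ->
  exists n L (Z : set 'rV[int]_d), [/\ (0 < n)%N,
    forall x : Rn R d, Z (grid_index n x) -> half_open_cube L x &
    (leb [set x : Rn R d | ~ (E x <-> Z (grid_index n x))] < e%:E)%E].
Proof.
move=> mE Eoo e0; have e3 : 0 < e / 3 by rewrite divr_gt0.
have Efin : leb E \is a fin_num by rewrite ge0_fin_numE.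
have [_ [/= F [mF EF] <-] FE] := lb_ereal_inf_adherent e3 Efin.
pose G : set (Rn R d) := \bigcup_k F k.
have mGb : measurable (G : set (borelRn R d)) by exact: bigcup_measurable.
have mG : measurable G by exact: measurable_Rn_borel.
have GE : (leb G < leb E + (e / 3)%:E)%E.
  by apply: le_lt_trans FE; apply: ereal_inf_lbound; exists F; split.
have Goo : (leb G < +oo)%E.
  by apply: lt_trans GE _; rewrite lte_add_pinfty// ltry.
have GEe : (leb (G `\` E) < (e / 3)%:E)%E.
  rewrite measureD//= (setIidr (EF : E `<=` G)).
  by rewrite lteBlDl.
pose T L := G `\` half_open_cube L.
have mT L : measurable (T L).
  by apply: measurableD => //; exact: measurable_half_open_cube.
have [|||L TL] := @lebesgueRn_tail R d T (e / 3) mT _ _ _ e3.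
- by apply: le_lt_trans Goo; apply: lebesgueRn_le => x [].
- move=> n x [Gx Kx]; split => // Kx'; apply: Kx.
  exact: half_open_cube_le Kx'.
- rewrite -subset0 => x Tx; pose r := \big[Num.max/0]_(i < d) `|x ord0 i|.
  have [n rn] : exists n : nat, r < n%:R.
    by exists (Num.trunc r).+1; rewrite truncnS_gt.
  have [_ ] := Tx n I; apply => i.
  have : `|x ord0 i| < n%:R by apply: le_lt_trans rn; exact: le_bigmax.
  by rewrite ltr_norml => /andP[/ltW -> ->].
have [_ aG] := borel_grid_approximable L mGb.
have [n n0 [Z ZG]] := aG _ e3.
pose Z' := Z `&` index_cube (n * L).
have KL (x : Rn R d) : half_open_cube L x <-> index_cube (n * L) (grid_index n x).
  by rewrite (@half_open_cubeE R d n)//.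
exists n, L, Z'; split => //; first by move=> x [_ /KL].
have -> : e = e / 3 + e / 3 + e / 3 by lra.
rewrite !EFinD.
apply: le_lt_trans (lteD (lteD GEe TL) ZG).
apply: le_trans (leeD2r _ (lebesgueRn_U2 _ _)).
apply: le_trans (lebesgueRn_U2 _ _); apply: lebesgueRn_le => x /= Hx.
have [[Gx nEx]|GEx] := pselect ((G `\` E) x); first by left; left.
have [Tx|nTx] := pselect (T L x); first by left; right.
have GEx' : E x <-> G x.
  split => [|Gx]; first exact: EF.
  by apply: contrapT => nEx; apply: GEx.
right; split.
  apply: contrapT => nKx; apply: Hx; rewrite /Z' /= GEx' -KL.
  by split => [Gx|[]//]; exfalso; apply: nTx.
move=> GZ; apply: Hx; rewrite /Z' /= GEx' -KL GZ; split => [Zx|[]//].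
split => //; apply: contrapT => nKx; apply: nTx; split => //.
by rewrite GZ.
Qed.

Variable B : completeNormedModType R.
Implicit Types f g h : Rn R d -> B.

(** The second parameter bounds the support, so that a grid step function takes
    finitely many values. *)
Definition grid_step (n L : nat) g : Prop := [/\ (0 < n)%N,
  exists c : 'rV[int]_d -> B, forall x : Rn R d, g x = c (grid_index n x) &
  forall x, ~ half_open_cube L x -> g x = 0].

Lemma grid_step_refine n L m g : (0 < m)%N ->
  grid_step n L g -> grid_step (n * m) L g.
Proof.
move=> m0 [n0 [c gc] g0]; split => //; first by rewrite muln_gt0 n0.
exists (c \o coarsen m) => x; rewrite gc /=; congr c.
exact: grid_index_coarsen.
Qed.

Lemma grid_step_widen n L M g : (L <= M)%N ->
  grid_step n L g -> grid_step n M g.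
Proof.
move=> LM [n0 cg g0]; split => // x Mx; apply: g0 => Lx; apply: Mx.
exact: half_open_cube_le Lx.
Qed.

Lemma grid_stepD n L f g : grid_step n L f -> grid_step n L g ->
  grid_step n L (fun x => f x + g x).
Proof.
move=> [n0 [c fc] f0] [_ [c' gc] g0]; split => //.
  by exists (fun z => c z + c' z) => x; rewrite fc gc.
by move=> x Lx; rewrite f0// g0// addr0.
Qed.

Lemma grid_step_simple n L g : grid_step n L g -> bochner_simple leb g.
Proof.
move=> [n0 [c gc] g0].
have gE Y : g @^-1` Y = grid_index n @^-1` (c @^-1` Y).
  by apply/seteqP; split => x /=; rewrite gc.
apply: bochner_simpleP.
- have fI := finite_index_cube d (n * L).
  apply: (@sub_finite_set _ _ (c @` index_cube (n * L) `|` [set 0])).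
    move=> _ [x _ <-]; have [Kx|Kx] := pselect (half_open_cube L x).
      left; exists (grid_index n x); last by rewrite gc.
      by rewrite (@half_open_cubeE R d n) in Kx.
    by right; rewrite g0.
  by rewrite finite_setU; split; [exact: finite_image|exact: finite_set1].
- by move=> Y; rewrite gE; exact: measurable_grid.
- apply: le_lt_trans (lebesgueRn_half_open_cube_lty R d L).
  by apply: lebesgueRn_le => x /= gx; apply: contrapT => /g0.
Qed.

Lemma grid_step_measurable n L g : grid_step n L g -> bochner_measurable leb g.
Proof. by move/grid_step_simple/bochner_simple_measurable. Qed.

Section density.
Variable p : R.
Hypothesis p1 : 1 <= p.
Let p_gt0 : 0 < p. Proof. exact: lt_le_trans p1. Qed.
Local Notation N := (bochner_Lnorm leb p).

Definition grid_step_limit f := forall e : R, 0 < e ->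
  exists2 g, (exists n L, grid_step n L g) & (N (fun x => f x - g x)%R < e%:E)%E.

Lemma Rn_Lnorm_triangle f g h : bochner_measurable leb f ->
  bochner_measurable leb g -> bochner_measurable leb h ->
  (forall x, `|f x| <= `|g x| + `|h x|) -> (N f <= N g + N h)%E.
Proof.
move=> mf mg mh.
have mn u := @bochner_measurable_normr _ _ _ _ B (@lebesgueRn_complete R d) u.
exact (@bochner_Lnorm_triangle _ (Rn R d) R leb p p1 B f g h
  (mn _ mf) (mn _ mg) (mn _ mh)).
Qed.

Lemma bochner_measurable_normrB f g : bochner_measurable leb f ->
  bochner_measurable leb g -> measurable_fun setT (fun x => `|f x - g x|).
Proof.
move=> mf mg; apply: (bochner_measurable_normr (@lebesgueRn_complete R d)).
exact: bochner_measurableB.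
Qed.

Lemma grid_step_limitD f g : bochner_measurable leb f ->
  bochner_measurable leb g -> grid_step_limit f -> grid_step_limit g ->
  grid_step_limit (fun x => f x + g x).
Proof.
move=> mf mg lf lg e e0; have e2 : 0 < e / 2 by rewrite divr_gt0.
have [u [n [L su]] fu] := lf _ e2; have [v [m [M sv]] gv] := lg _ e2.
have n0 : (0 < n)%N by case: su.
have m0 : (0 < m)%N by case: sv.
have mu := grid_step_measurable su; have mv := grid_step_measurable sv.
exists (fun x => u x + v x).
  exists (n * m)%N, (maxn L M); apply: grid_stepD.
    by apply: grid_step_widen (leq_maxl _ _) _; exact: grid_step_refine.
  rewrite mulnC.
  by apply: grid_step_widen (leq_maxr _ _) _; exact: grid_step_refine.
rewrite (splitr e) EFinD; apply: le_lt_trans (lteD fu gv).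
apply: Rn_Lnorm_triangle.
- by apply: bochner_measurableB; exact: bochner_measurableD.
- exact: bochner_measurableB.
- exact: bochner_measurableB.
- move=> x; rewrite opprD addrACA; exact: ler_normD.
Qed.

Lemma grid_step_limit_indic (E : set (Rn R d)) (b : B) : measurable E ->
  (leb E < +oo)%E -> grid_step_limit (patch (fun=> 0) E (fun=> b)).
Proof.
move=> mE Eoo e e0.
(* The summand 1 keeps c positive when b = 0. *)
pose c := `|b| `^ p + 1; have c0 : 0 < c by rewrite ltr_wpDl// powR_ge0.
have q0 : 0 < e `^ p / c by rewrite divr_gt0// powR_gt0.
have [n [L [Z [n0 ZL EZ]]]] := measurable_grid_approx mE Eoo q0.
pose D : set (Rn R d) := grid_index n @^-1` Z.
have mD : measurable D by exact: measurable_grid.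
exists (patch (fun=> 0) D (fun=> b)).
  exists n, L; split => //.
    by exists (patch (fun=> 0) Z (fun=> b)).
  move=> x Kx; rewrite patch0E memNset// => /ZL; exact: Kx.
set S := [set x | _] in EZ.
have SE : S = (E `\` D) `|` (D `\` E).
  apply/seteqP; split => x; rewrite /S /D /=.
    move=> H; have [Ex|Ex] := pselect (E x).
      by left; split => // Zx; apply: H.
    right; split => //; apply: contrapT => Zx; apply: H; split => //.
  by move=> [[Ex Zx] H|[Zx Ex] H]; [apply: Zx; exact/H|apply: Ex; exact/H].
have mS : measurable S by rewrite SE; apply: measurableU; exact: measurableD.
rewrite bochner_Lnorm_lt ?(ltW e0)//.
rewrite (eq_integral (fun x => ((`|b| `^ p)%:E * (\1_S x)%:E)%E)); last first.
  move=> x _; rewrite !patch0E indicE -EFinM SE in_setU !in_setD.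
  case: (x \in E); case: (x \in D);
    rewrite /= ?subrr ?subr0 ?sub0r ?normrN ?mulr1 ?mulr0//.
  - by rewrite normr0 powR0// gt_eqF.
  - by rewrite normr0 powR0// gt_eqF.
rewrite ge0_integralZl_EFin ?powR_ge0//; last first.
  exact/measurable_EFinP/measurable_indic.
rewrite integral_indic// setIT.
apply: (@le_lt_trans _ _ (c%:E * leb S)%E).
  by apply: lee_wpmul2r => //; rewrite lee_fin lerDl.
by rewrite muleC -lte_pdivlMr// -EFinM.
Qed.

Lemma grid_step_limit_simple f : bochner_simple leb f -> grid_step_limit f.
Proof.
move=> sf; have [ff mf muf] := sf.
pose r : seq B := finmap.enum_fset (fset_set (range f)).
pose u b := patch (fun=> 0) (f @^-1` [set b]) (fun=> b).
have fE : f = fun x => \sum_(b <- r) u b x.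
  apply/funext => x; rewrite (bigD1_seq (f x))//=.
  - rewrite big1 ?addr0; first by rewrite /u patch0E mem_set.
    move=> b bx; rewrite /u patch0E memNset// => /= fxb.
    by rewrite fxb eqxx in bx.
  - by rewrite in_fset_set// mem_set//; exists x.
  - exact: finmap.fset_uniq.
have [mlim] : bochner_measurable leb (fun x => \sum_(b <- r) u b x) /\
              grid_step_limit (fun x => \sum_(b <- r) u b x); last by rewrite -fE.
elim: r {fE} => [|b r [mIH IH]].
  have z0 : (fun x : Rn R d => \sum_(b <- [::]) u b x) = fun=> 0.
    by apply/funext => x; rewrite big_nil.
  rewrite z0; split; first exact/bochner_simple_measurable/bochner_simple_cst0.
  move=> e e0; exists (fun=> 0).
    by exists 1%N, 0%N; split => //; exists (fun=> 0).
  rewrite bochner_Lnorm_lt ?(ltW e0)//.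
  under eq_integral do rewrite subrr normr0 powR0 ?gt_eqF//.
  by rewrite integral0 lte_fin powR_gt0.
have -> : (fun x : Rn R d => \sum_(b <- b :: r) u b x) =
    fun x => u b x + \sum_(b <- r) u b x.
  by apply/funext => x; rewrite big_cons.
have [b0|b0] := eqVneq b 0.
  have -> // : (fun x => u b x + \sum_(b <- r) u b x) =
      fun x => \sum_(b <- r) u b x.
  by apply/funext => x; rewrite /u patch0E b0; case: ifP; rewrite add0r.
have mub : bochner_measurable leb (u b).
  apply: bochner_simple_measurable; apply: bochner_simple_indic => //.
  exact: muf.
split; first exact: bochner_measurableD.
apply: grid_step_limitD => //; apply: grid_step_limit_indic => //.
exact: muf.
Qed.

(** Through simple functions, whose level sets of finite measure are
    approximated by finite unions of cells. *)
Lemma grid_step_dense f : bochner_measurable leb f -> (N f < +oo)%E ->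
  grid_step_limit f.
Proof.
move=> mf foo e e0; have e2 : 0 < e / 2 by rewrite divr_gt0.
have [s ss fs] := bochner_simple_dense (@lebesgueRn_complete R d) p1 mf foo e2.
have [g [n [L sg]] sgs] := grid_step_limit_simple ss e2.
exists g; first by exists n, L.
have ms := bochner_simple_measurable ss; have mg := grid_step_measurable sg.
rewrite (splitr e) EFinD; apply: le_lt_trans (lteD fs sgs).
apply: Rn_Lnorm_triangle.
- exact: bochner_measurableB.
- exact: bochner_measurableB.
- exact: bochner_measurableB.
- by move=> x; rewrite -[f x - g x](subrKA (s x)); exact: ler_normD.
Qed.

End density.

End grid_steps.

(** * Translations *)

Section translation.
Variables (R : realType) (d : nat) (B : completeNormedModType R).
Local Notation leb := (@lebesgueRn R d).
Implicit Types f g : Rn R d -> B.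

Lemma bochner_measurable_translate h f : bochner_measurable leb f ->
  bochner_measurable leb (translate h f).
Proof.
move=> [s [ss [N [mN N0 sN]]]]; exists (fun n => translate h (s n)); split.
  move=> n; have [fs ms mus] := ss n.
  have pre b : translate h (s n) @^-1` [set b] =
    (fun x => x + h) @^-1` (s n @^-1` [set b]) by [].
  split.
  - by apply: sub_finite_set fs => _ [x _ <-]; exists (x + h).
  - by move=> b; rewrite pre; exact: measurable_Rn_preimage_shift.
  - move=> b b0; rewrite pre; apply: le_lt_trans (mus _ b0).
    by rewrite le_eqVlt; apply/orP; left; apply/eqP; exact: lebesgueRn_shift.
exists ((fun x => x + h) @^-1` N); split.
- exact: measurable_Rn_preimage_shift.
- by rewrite -N0; exact: lebesgueRn_shift.
- by move=> x /= H; apply: sN => /= H'; apply: H.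
Qed.

Variable p : R.
Hypothesis p1 : 1 <= p.
Let p_gt0 : 0 < p. Proof. exact: lt_le_trans p1. Qed.
Local Notation N := (bochner_Lnorm leb p).

Lemma Lnorm_translate h f : bochner_measurable leb f ->
  N (translate h f) = N f.
Proof.
move=> mf; rewrite !bochner_LnormE; congr (_ `^ _)%E.
rewrite -(@ge0_integral_shift R d h (fun x => (`|f x| `^ p)%:E))//.
apply: measurable_EFin_powR.
exact: (bochner_measurable_normr (@lebesgueRn_complete R d) mf).
Qed.

Lemma finite_int_interval (m : nat) : finite_set [set k : int | `|k| <= m%:Z].
Proof.
pose f (j : nat) : int := j%:Z - m%:Z.
apply: sub_finite_set (finite_image f (finite_II (2 * m).+1)) => k /= km.
exists `|(k + m%:Z)%R|%N; first lia.
by rewrite /f gez0_abs ?addrK//; lia.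
Qed.

Lemma grid_step_bounded n L g : grid_step n L g ->
  exists2 C : R, 0 < C & forall x, `|g x| <= C.
Proof.
move=> /grid_step_simple[fg _ _].
exists (1 + \sum_(b <- finmap.enum_fset (fset_set (range g))) `|b|).
  by rewrite ltr_wpDr// sumr_ge0.
move=> x; rewrite (bigD1_seq (g x))//=.
- by rewrite ler_wpDl// ler_wpDr// sumr_ge0.
- by rewrite in_fset_set// mem_set//; exists x.
- exact: finmap.fset_uniq.
Qed.

(** When the integer parts differ, the larger one divided by n is a grid point
    between u and u + t. *)
Lemma floor_neq_separated (n : nat) (u t : R) : (0 < n)%N ->
  Num.floor (n%:R * (u + t)) != Num.floor (n%:R * u) ->
  exists2 k : int, `|u - k%:~R / n%:R| <= `|t| &
    `|k%:~R| <= n%:R * (`|u| + `|t|).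
Proof.
move=> n0; have n0R : 0 < n%:R :> R by rewrite ltr0n.
set a := Num.floor (n%:R * u); set b := Num.floor (n%:R * (u + t)).
have /andP[a1 a2] : a%:~R <= n%:R * u < (a + 1)%:~R by exact: floor_itv.
have /andP[b1 b2] : b%:~R <= n%:R * (u + t) < (b + 1)%:~R by exact: floor_itv.
rewrite neq_lt => /orP[ba|ab].
- have ba' : (b + 1)%:~R <= a%:~R :> R by rewrite ler_int lezD1.
  have ua : a%:~R / n%:R <= u by rewrite ler_pdivrMr// mulrC.
  have ua' : u + t < a%:~R / n%:R by rewrite ltr_pdivlMr// mulrC; lra.
  have t0 : t < 0 by lra.
  exists a; first by rewrite (ltr0_norm t0) ler_norml; lra.
  have -> : (a%:~R : R) = n%:R * (a%:~R / n%:R) by rewrite mulrC divfK ?gt_eqF.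
  rewrite normrM (gtr0_norm n0R) ler_pM2l//.
  have := ler_norm u; have := ler_norm (- u); rewrite normrN (ltr0_norm t0).
  by rewrite ler_norml; lra.
- have ab' : (a + 1)%:~R <= b%:~R :> R by rewrite ler_int lezD1.
  have ub : b%:~R / n%:R <= u + t by rewrite ler_pdivrMr// mulrC.
  have ub' : u < b%:~R / n%:R by rewrite ltr_pdivlMr// mulrC; lra.
  have t0 : 0 < t by lra.
  exists b; first by rewrite (gtr0_norm t0) ler_norml; lra.
  have -> : (b%:~R : R) = n%:R * (b%:~R / n%:R) by rewrite mulrC divfK ?gt_eqF.
  rewrite normrM (gtr0_norm n0R) ler_pM2l//.
  have := ler_norm u; have := ler_norm (- u); rewrite normrN (gtr0_norm t0).
  by rewrite ler_norml; lra.
Qed.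

(** A step function and its translate by a small vector differ only in thin
    slabs along the faces of the grid. *)
Lemma grid_step_translate n L g (e : R) : grid_step n L g -> 0 < e ->
  exists2 delta : R, 0 < delta & forall h : Rn R d,
    (forall i, `|h ord0 i| <= delta) ->
    (N (fun x => translate h g x - g x)%R < e%:E)%E.
Proof.
move=> sg e0; have [C C0 gC] := grid_step_bounded sg.
have [n0 [c gc] g0] := sg.
(* Translations by at most 1 keep the support in the cube of half side L + 1,
   and the separating grid points in that of half side L + 2. *)
pose L' := (L + 1)%N; pose M := (n * (L + 2))%N.
pose D : set ('I_d * int) := setT `*` [set k : int | `|k| <= M%:Z].
have fD : finite_set D.
  apply: finite_setX; [exact: finite_finset|exact: finite_int_interval].
pose r := finmap.enum_fset (fset_set D).
pose S delta (j : 'I_d * int) := @slab R d L' j.1 (j.2%:~R / n%:R) delta.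
pose c1 : R := \sum_(j <- r) (2 * (2 * L'%:R) ^+ d.-1).
have c10 : 0 <= c1.
  by apply: sumr_ge0 => j _; rewrite mulr_ge0// exprn_ge0// mulr_ge0.
pose W delta := \bigcup_(j in D) S delta j.
have mS delta j : 0 <= delta -> measurable (S delta j).
  by move=> d0; have [] := @slab_measure R d L' j.1 (j.2%:~R / n%:R) delta d0.
have mW delta : 0 <= delta -> measurable (W delta).
  by move=> d0; apply: fin_bigcup_measurable => // j _; exact: mS.
have muW delta : 0 <= delta -> (leb (W delta) <= (delta * c1)%:E)%E.
  move=> d0; apply: (@le_trans _ _ (\sum_(j \in D) leb (S delta j))%E).
    apply: content_sub_fsum => //; last exact: mW.
    by move=> j _; exact: mS.
  rewrite fsbig_finite//= /c1 mulr_sumr -sumEFin; apply: lee_sum => j _.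
  have [_] := @slab_measure R d L' j.1 (j.2%:~R / n%:R) delta d0.
  by rewrite mulrA (mulrC delta).
pose Q := (2 * C) `^ p; have Q0 : 0 < Q by rewrite powR_gt0// mulr_gt0.
have Qc0 : 0 <= Q * c1 by rewrite mulr_ge0// ltW.
pose delta := Num.min 1 (e `^ p / (Q * c1 + 1)).
have q0 : 0 < e `^ p / (Q * c1 + 1) by rewrite divr_gt0 ?powR_gt0// ltr_wpDl.
have delta0 : 0 < delta by rewrite lt_min ltr01.
exists delta => // h hd.
have d1 : delta <= 1 by rewrite ge_min lexx.
have dq : delta <= e `^ p / (Q * c1 + 1) by rewrite ge_min lexx orbT.
have bad x : g (x + h) != g x -> W delta x.
  move=> gx.
  have xL j : `|x ord0 j| <= L'%:R.
    have hj := hd j; rewrite natrD.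
    have [Kx|Kx] := pselect (half_open_cube L x).
      have /andP[? ?] := Kx j; rewrite ler_norml; apply/andP; split; lra.
    have [Kx'|Kx'] := pselect (half_open_cube L (x + h)).
      have := Kx' j; rewrite mxE => /andP[? ?].
      move: hj; rewrite !ler_norml => /andP[? ?]; apply/andP; split; lra.
    by rewrite g0// g0// eqxx in gx.
  have [i ni] : exists i, grid_index n (x + h) ord0 i != grid_index n x ord0 i.
    apply: contrapT => H; move: gx; rewrite !gc => /eqP; apply; congr c.
    by apply/rowP => i; apply/eqP; apply: contrapT => /negP ?; apply: H; exists i.
  move: ni; rewrite !mxE => /(floor_neq_separated n0)[k k1 k2].
  exists (i, k).
    split => //=; rewrite -(ler_int R) intr_norm (le_trans k2)// /M.
    rewrite -pmulrn natrM ler_wpM2l// natrD.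
    have := xL i; have := hd i; rewrite natrD; lra.
  by split => //=; exact: le_trans (hd i).
rewrite bochner_Lnorm_lt ?(ltW e0)//.
have mg := grid_step_measurable sg.
apply: (@le_lt_trans _ _ (\int[leb]_x (Q%:E * (\1_(W delta) x)%:E))%E).
  apply: ge0_le_integral.
  - exact: measurableT.
  - by move=> x _; rewrite lee_fin powR_ge0.
  - apply: measurable_EFin_powR; apply: bochner_measurable_normrB => //.
    exact: bochner_measurable_translate.
  - apply: measurable_funeM; apply/measurable_EFinP/measurable_indic.
    by apply: mW; exact: ltW.
  - move=> x _; rewrite -EFinM lee_fin /translate indicE.
    have [gx|gx] := eqVneq (g (x + h)) (g x).
      by rewrite gx subrr normr0 powR0 ?gt_eqF// mulr_ge0// ltW.
    rewrite mem_set; last exact: bad.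
    rewrite mulr1 (ge0_ler_powR (ltW p_gt0)) ?nnegrE ?mulr_ge0 ?(ltW C0)//.
    rewrite (le_trans (ler_normB _ _))//.
    by have := gC x; have := gC (x + h); lra.
rewrite ge0_integralZl_EFin ?(ltW Q0)//; last first.
  by apply/measurable_EFinP/measurable_indic/mW/ltW.
rewrite integral_indic ?setIT//; last by apply: mW; exact: ltW.
apply: (@le_lt_trans _ _ (Q%:E * (delta * c1)%:E)%E).
  by rewrite lee_wpmul2l ?lee_fin ?(ltW Q0)// muW// ltW.
rewrite -EFinM lte_fin mulrCA; apply: le_lt_trans (ler_wpM2r Qc0 dq) _.
rewrite mulrAC ltr_pdivrMr ?ltr_wpDl// ltr_pM2l ?powR_gt0//.
by rewrite ltrDl.
Qed.

End translation.

(** * Averages over cells *)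

Section cell_average.
Variables (R : realType) (d : nat) (B : completeNormedModType R).
Local Notation leb := (@lebesgueRn R d).
Implicit Types f g : Rn R d -> B.

Definition cell_average (n L : nat) f : Rn R d -> B :=
  patch (fun=> 0) (half_open_cube L) (fun x =>
    n%:R ^+ d *: bochner_integral leb (grid_cell n (grid_index n x)) f).

Lemma grid_step_cell_average n L f : (0 < n)%N ->
  grid_step n L (cell_average n L f).
Proof.
move=> n0; split => //; last first.
  by move=> x Kx; rewrite /cell_average patch0E memNset.
exists (patch (fun=> 0) (index_cube (n * L)) (fun z =>
  n%:R ^+ d *: bochner_integral leb (grid_cell n z) f)) => x.
rewrite /cell_average !patch0E; congr (if _ then _ else _).
by rewrite (@half_open_cubeE R d n)//; apply/idP/idP; rewrite !inE.
Qed.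

(** The indices of two fine cells in the same coarse cell differ by at most m in
    each coordinate; these are all the candidates for the difference. *)
Definition offset_index (m : nat) (j : {ffun 'I_d -> 'I_(2 * m).+1}) :
  'rV[int]_d := \row_i ((j i)%:Z - m%:Z).

Definition offset (n m : nat) (j : {ffun 'I_d -> 'I_(2 * m).+1}) : Rn R d :=
  \row_i ((offset_index j ord0 i)%:~R / (n * m)%:R).

Lemma offset_le n m (j : {ffun 'I_d -> 'I_(2 * m).+1}) i :
  (0 < n)%N -> (0 < m)%N ->
  `|offset n j ord0 i| <= n%:R^-1 :> R.
Proof.
move=> n0 m0; have n0R : 0 < n%:R :> R by rewrite ltr0n.
have m0R : 0 < m%:R :> R by rewrite ltr0n.
rewrite /offset !mxE normrM normfV natrM.
rewrite (ger0_norm (mulr_ge0 (ltW n0R) (ltW m0R))) invfM mulrCA.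
rewrite ler_piMr ?invr_ge0 ?(ltW n0R)//.
rewrite ler_pdivrMr// mul1r -intr_norm pmulrn ler_int.
by have := ltn_ord (j i); lia.
Qed.

(** A point of the coarse cell of x lies in a fine cell obtained from that of
    x by one of finitely many offsets, at which the step function takes the
    value g (x + h); the weight m^-d is the ratio of the volumes of a fine and
    a coarse cell. *)
Lemma cell_average_pointwise n m M g x : (0 < n)%N -> (0 < m)%N ->
  grid_step (n * m) M g ->
  `|g x - n%:R ^+ d *: bochner_integral leb (grid_cell n (grid_index n x)) g| <=
  m%:R^-1 ^+ d * \sum_(j : {ffun 'I_d -> 'I_(2 * m).+1})
     `|translate (offset n j) g x - g x|.
Proof.
move=> n0 m0 sg; set Q := grid_cell n _.
have nm0 : (0 < n * m)%N by rewrite muln_gt0 n0.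
have n0R : 0 < n%:R :> R by rewrite ltr0n.
have m0R : 0 < m%:R :> R by rewrite ltr0n.
have [_ [c gc] _] := sg.
have sg' := grid_step_simple sg; have mg := bochner_simple_measurable sg'.
have cmu := @lebesgueRn_complete R d.
have muQ : leb Q = (n%:R^-1 ^+ d)%:E by exact: lebesgueRn_grid_cell.
have mQ : measurable Q by exact: measurable_grid.
have Qoo : (leb Q < +oo)%E by rewrite muQ ltry.
have nd0 : 0 < n%:R ^+ d :> R by rewrite exprn_gt0.
have gx : g x = n%:R ^+ d *: bochner_integral leb Q (fun=> g x).
  rewrite (bochner_integral_cst cmu)// [X in fine X]muQ scalerA -exprMn.
  by rewrite divff ?gt_eqF// expr1n scale1r.
rewrite {1}gx -scalerBr normrZ (gtr0_norm nd0).
have -> : m%:R^-1 ^+ d = n%:R ^+ d * (n * m)%:R^-1 ^+ d :> R.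
  by rewrite natrM invfM -exprMn mulrA divff ?mul1r// gt_eqF.
rewrite -mulrA ler_pM2l// -lee_fin.
have sQ : bochner_simple leb (patch (fun=> 0) Q (fun=> g x)).
  exact: bochner_simple_indic.
rewrite -(bochner_integral_patch leb Q (fun=> g x)).
apply: le_trans (bochner_integral_dist cmu mQ
  (bochner_simple_measurable sQ) mg _ _) _.
- by apply: bochner_simple_integrable; exact: bochner_simple_patch.
- by apply: bochner_simple_integrable; exact: bochner_simple_patch.
pose cell (j : {ffun 'I_d -> 'I_(2 * m).+1}) : set (Rn R d) :=
  grid_cell (n * m) (grid_index (n * m) x + offset_index j).
pose v (j : {ffun 'I_d -> 'I_(2 * m).+1}) := `|translate (offset n j) g x - g x|.
have vi0 j (y : Rn R d) : (0 <= (v j)%:E * (\1_(cell j) y)%:E)%E.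
  by rewrite -EFinM lee_fin mulr_ge0// normr_ge0.
have mcell j : measurable (cell j) by exact: measurable_grid.
have int_cell j (a : R) : 0 <= a ->
    (\int[leb]_y (a%:E * (\1_(cell j) y)%:E))%E = (a * (n * m)%:R^-1 ^+ d)%:E.
  move=> a0; have muc : leb (cell j) = ((n * m)%:R^-1 ^+ d)%:E.
    exact: lebesgueRn_grid_cell.
  rewrite ge0_integralZl_EFin//; last exact/measurable_EFinP/measurable_indic.
  by rewrite integral_indic// setIT EFinM -muc.
have mind j : measurable_fun setT
    (fun y : Rn R d => ((v j)%:E * (\1_(cell j) y)%:E)%E).
  by apply: measurable_funeM; exact/measurable_EFinP/measurable_indic.
apply: (@le_trans _ _ (\int[leb]_y \sum_(j : {ffun 'I_d -> 'I_(2 * m).+1})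
    ((v j)%:E * (\1_(cell j) y)%:E))%E).
  apply: ge0_le_integral.
  - exact: measurableT.
  - by move=> y _; rewrite lee_fin.
  - apply/measurable_EFinP; apply: (bochner_measurable_normr cmu).
    apply: bochner_measurable_patch => //; apply: bochner_measurableB => //.
    exact: bochner_simple_measurable.
  - exact: emeasurable_sum.
  - move=> y _; rewrite patch0E; case: ifPn => [yQ|_]; last first.
      by rewrite normr0 sume_ge0.
    rewrite patch0E yQ.
    have {yQ} yx : grid_index n y = grid_index n x by move: yQ; rewrite inE.
    pose w := grid_index (n * m) y - grid_index (n * m) x.
    have wm i : `|w ord0 i| <= m%:Z.
      have /rowP/(_ i) := yx; rewrite !(grid_index_coarsen n _ m0) !mxE.
      set a := Num.floor _; set b := Num.floor _ => ab.
      have := divz_eq a m%:Z; have := divz_eq b m%:Z; rewrite ab.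
      have m0Z : m%:Z != 0 by lia.
      have := modz_ge0 a m0Z; have := modz_ge0 b m0Z.
      have := ltz_pmod a (_ : 0 < m%:Z); have := ltz_pmod b (_ : 0 < m%:Z).
      by lia.
    have jP i : (`|(w ord0 i + m%:Z)%R| < (2 * m).+1)%N by have := wm i; lia.
    pose j := [ffun i => Ordinal (jP i)].
    have jw : offset_index j = w.
      apply/rowP => i; rewrite !mxE ffunE /= gez0_abs ?addrK ?mxE//.
      by have := wm i; rewrite !mxE; lia.
    have yj : grid_index (n * m) x + offset_index j = grid_index (n * m) y.
      by rewrite jw /w addrC subrK.
    rewrite (bigD1 j)//= indicE mem_set; last by rewrite /cell /grid_cell /= yj.
    rewrite mule1 {1}/v /translate.
    have -> : g (x + offset n j) = g y.
      by rewrite !gc /offset grid_index_shift// yj.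
    by rewrite distrC leeDl// sume_ge0.
rewrite ge0_integral_sum//.
rewrite mulr_sumr -sumEFin; apply: lee_sum => j _.
by rewrite int_cell ?normr_ge0// mulrC.
Qed.

(** Minkowski's inequality over the offsets. The number of offsets is at most
    3 ^ d times the number of fine cells in a coarse one, whatever the ratio
    of the scales; this uniformity is what makes the bound pass to limits of
    step functions. *)
Lemma cell_average_dist (p : R) n m L M g (s : R) : 1 <= p -> 0 <= s ->
  (0 < n)%N -> (0 < m)%N -> grid_step (n * m) M g ->
  (forall h : Rn R d, (forall i, `|h ord0 i| <= n%:R^-1) ->
    (bochner_Lnorm leb p (fun x => translate h g x - g x)%R <= s%:E)%E) ->
  (bochner_Lnorm leb p (fun x =>
    patch (fun=> 0) (half_open_cube L) g x - cell_average n L g x)%R <=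
   (3 ^+ d * s)%:E)%E.
Proof.
move=> p1 s0 n0 m0 sg gs.
have m0R : 0 < m%:R :> R by rewrite ltr0n.
have cmu := @lebesgueRn_complete R d.
have mg := grid_step_measurable sg.
have ma := grid_step_measurable (grid_step_cell_average L g n0).
have mK := @measurable_half_open_cube R d L.
have mp : bochner_measurable leb (patch (fun=> 0) (half_open_cube L) g).
  exact: bochner_measurable_patch.
have md0 : 0 <= m%:R^-1 ^+ d :> R by rewrite exprn_ge0// invr_ge0 ltW.
pose u (j : {ffun 'I_d -> 'I_(2 * m).+1}) x := translate (offset n j) g x - g x.
apply: (@le_trans _ _ ((m%:R^-1 ^+ d)%:E *
    \sum_(j : {ffun 'I_d -> 'I_(2 * m).+1}) bochner_Lnorm leb p (u j))%E).
  have mdiff := bochner_measurable_normrB mp ma.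
  have mu j : measurable_fun setT (fun x => `|u j x|).
    exact: (bochner_measurable_normrB (bochner_measurable_translate _ mg) mg).
  apply: (@bochner_Lnorm_le_sum _ (Rn R d) R leb p p1 B _ _ _ u _ md0 mdiff mu).
  move=> x; rewrite /cell_average !patch0E; case: ifPn => _.
    exact: (cell_average_pointwise x n0 m0 sg).
  by rewrite subrr normr0 mulr_ge0// sumr_ge0.
apply: (@le_trans _ _ ((m%:R^-1 ^+ d)%:E *
    \sum_(j : {ffun 'I_d -> 'I_(2 * m).+1}) s%:E)%E).
  rewrite lee_wpmul2l ?lee_fin//; apply: lee_sum => j _.
  by apply: gs => i; exact: offset_le.
rewrite sumEFin sumr_const card_ffun !card_ord -EFinM lee_fin.
rewrite -(mulr_natl s) mulrA ler_wpM2r// natrX -exprMn.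
rewrite lerXn2r ?nnegrE ?mulr_ge0 ?invr_ge0//.
by rewrite ler_pdivrMl// -natrM ler_nat; lia.
Qed.

End cell_average.

(** * Euclidean norm and finite covers *)

Section euclidean_norm.
Variables (R : realType) (d : nat).
Implicit Types x : Rn R d.

Lemma coord_le_enorm x i : `|x ord0 i| <= enorm x.
Proof.
rewrite /enorm -sqrtr_sqr ler_wsqrtr// (bigD1 i)//= lerDl.
by apply: sumr_ge0 => j _; exact: sqr_ge0.
Qed.

Lemma enorm_le x (t : R) : 0 <= t -> (forall i, `|x ord0 i| <= t) ->
  enorm x <= Num.sqrt (d%:R * t ^+ 2).
Proof.
move=> t0 xt; rewrite /enorm ler_wsqrtr//.
apply: (@le_trans _ _ (\sum_(i < d) t ^+ 2)).
  by apply: ler_sum => i _; rewrite -real_normK ?num_real// lerXn2r ?nnegrE.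
by rewrite sumr_const card_ord mulr_natl.
Qed.

Lemma enorm_half_open_cube (L : nat) x : half_open_cube L x ->
  enorm x <= Num.sqrt (d%:R * L%:R ^+ 2).
Proof.
move=> Kx; apply: enorm_le => // i; have /andP[h1 h2] := Kx i.
by rewrite ler_norml h1 ltW.
Qed.

Lemma half_open_cube_enorm (L : nat) x : enorm x < L%:R -> half_open_cube L x.
Proof.
move=> xL i; have := le_lt_trans (coord_le_enorm x i) xL.
by rewrite ltr_norml => /andP[/ltW -> ->].
Qed.

Lemma enorm_small (delta : R) : 0 < delta -> exists2 n, (0 < n)%N &
  forall x, (forall i, `|x ord0 i| <= n%:R^-1) -> enorm x < delta.
Proof.
move=> delta0; pose b := d%:R / delta ^+ 2.
have d20 : 0 < delta ^+ 2 by rewrite exprn_gt0.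
have b0 : 0 <= b by rewrite divr_ge0// ltW.
(* With n > d / delta^2 one has d / n^2 <= d / n < delta^2. *)
pose n := (Num.trunc b).+1; exists n => // x xn.
have n0R : 0 < n%:R :> R by rewrite ltr0n.
have n1 : 1 <= n%:R :> R by rewrite ler1n.
apply: le_lt_trans (enorm_le _ xn) _; first by rewrite invr_ge0 ltW.
rewrite -(gtr0_norm delta0) -sqrtr_sqr ltr_sqrt//.
apply: (@le_lt_trans _ _ (d%:R / n%:R)).
  rewrite ler_wpM2l// expr2 ler_piMr ?invr_ge0 ?(ltW n0R)//.
  by rewrite invf_le1.
by rewrite ltr_pdivrMr// mulrC -ltr_pdivrMr// truncnS_gt.
Qed.

Lemma measurable_enorm_gt (r : R) : measurable [set x : Rn R d | r < enorm x].
Proof.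
apply: measurable_Rn_borel.
pose q (x : borelRn R d) : R := \sum_(i < d) (coordRn i x : R) ^+ 2.
have mq : measurable_fun setT q.
  apply: measurable_sum => i; apply: measurable_funX; exact: measurable_coordRn.
rewrite [X in measurable X](_ : _ = q @^-1` [set u | r < Num.sqrt u]); last by [].
rewrite -[X in measurable X]setTI; apply: mq => //.
rewrite [X in measurable X](_ : _ =
  setT `&` Num.sqrt @^-1` (`]r, +oo[%classic : set R)); last first.
  by rewrite setTI; apply/seteqP; split => u /=; rewrite in_itv/= andbT.
have ms : measurable_fun setT (@Num.sqrt R).
  by apply: continuous_measurable_fun; exact: sqrt_continuous.
by apply: ms => //; exact: measurable_itv.
Qed.

End euclidean_norm.

Section finite_covers.

Lemma finite_eventually (T : choiceType) (G : set T) (P : T -> nat -> Prop) :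
  finite_set G -> (forall g, G g -> \forall k \near \oo, P g k) ->
  \forall k \near \oo, forall g, G g -> P g k.
Proof.
move=> /finite_seqP[r ->]; elim: r => [|g r IH] H.
  by apply: nearW => k g.
have Hg : \forall k \near \oo, P g k by apply: H => /=; exact: mem_head.
have Hr : \forall k \near \oo, forall g, g \in r -> P g k.
  by apply: IH => g' /= g'r; apply: H; rewrite /= inE g'r orbT.
apply: filterS2 Hg Hr => k Pg Pr g' /=.
by rewrite inE => /orP[/eqP ->//|]; exact: Pr.
Qed.

(** Intersecting the preimages of the finite covers of the images, one map
    after the other, keeps the number of pieces finite. *)
Lemma totally_bounded_common_cover (R : realType) (B : normedModType R)
    (V : Type) (S : set V) (I : choiceType) (D : set I) (phi : I -> V -> B)
    (eta : R) : finite_set D -> 0 < eta ->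
  (forall i, D i -> totally_bounded (fun y z : B => (`|y - z|)%:E)
     [set phi i f | f in S]) ->
  exists C : set (set V), [/\ finite_set C, S `<=` \bigcup_(U in C) U &
    forall U, C U -> U `<=` S /\
      forall i, D i -> forall f g, U f -> U g -> `|phi i f - phi i g| < eta].
Proof.
move=> /finite_seqP[r ->] eta0; elim: r => [|i r IH] tb.
  exists [set S]; split => [//|f Sf|U ->].
    by exists S.
  by split => // i; rewrite /= in_nil.
have [|C [fC SC CP]] := IH.
  by move=> j /= jr; apply: tb; rewrite /= inE jr orbT.
have [|K [fK KP SK]] := tb i _ eta eta0; first exact: mem_head.
exists [set U `&` phi i @^-1` W | U in C & W in K]; split.
- exact: finite_image2.
- move=> f Sf; have [U CU Uf] := SC _ Sf.
  have [W KW Wf] : (\bigcup_(U in K) U) (phi i f) by apply: SK; exists f.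
  by exists (U `&` phi i @^-1` W) => //; exists U => //; exists W.
- move=> _ [U CU [W KW <-]]; have [US UP] := CP _ CU; split.
    by move=> f [/US].
  move=> j /=; rewrite inE => /orP[/eqP ->|jr] f g [Uf Wf] [Ug Wg];
    last exact: UP.
  rewrite -lte_fin; apply: le_lt_trans (KP _ KW).
  by apply: ereal_sup_ubound; exists (phi i f, phi i g).
Qed.

Lemma diameter_le (R : realType) (T : Type) (dist : T -> T -> \bar R)
    (U : set T) (e : R) : (forall x y, U x -> U y -> (dist x y <= e%:E)%E) ->
  (diameter dist U <= e%:E)%E.
Proof.
by move=> H; apply: ge_ereal_sup => _ [[x y] [Ux Uy] <-]; exact: H.
Qed.

Lemma dist_le_diameter (R : realType) (T : Type) (dist : T -> T -> \bar R)
    (U : set T) x y : U x -> U y -> (dist x y <= diameter dist U)%E.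
Proof. by move=> Ux Uy; apply: ereal_sup_ubound; exists (x, y). Qed.

End finite_covers.

(** * Necessity *)

Section kolmogorov_riesz_directions.
Variables (R : realType) (d : nat) (B : completeNormedModType R).
Variable p : R.
Hypothesis p1 : 1 <= p.
Let p_gt0 : 0 < p. Proof. exact: lt_le_trans p1. Qed.
Local Notation leb := (@lebesgueRn R d).
Local Notation N := (bochner_Lnorm leb p).
Implicit Types (f g : Rn R d -> B) (F : set (Lp leb B p)).

Let cmu := @lebesgueRn_complete R d.

Lemma Lp_fun_measurable (f : Lp leb B p) : bochner_measurable leb f.
Proof. exact: LpFun_measurable. Qed.

Lemma Lp_fun_finite (f : Lp leb B p) : (N f < +oo)%E.
Proof. exact: LpFun_finite. Qed.

Lemma Lnorm_sym f g : N (fun x => f x - g x)%R = N (fun x => g x - f x)%R.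
Proof. by apply: eq_bochner_Lnorm => x; exact: distrC. Qed.

Lemma Lnorm_dist_triangle f g h : bochner_measurable leb f ->
  bochner_measurable leb g -> bochner_measurable leb h ->
  (N (fun x => f x - h x)%R <=
   N (fun x => f x - g x)%R + N (fun x => g x - h x)%R)%E.
Proof.
move=> mf mg mh; apply: (Rn_Lnorm_triangle p1).
- exact: bochner_measurableB.
- exact: bochner_measurableB.
- exact: bochner_measurableB.
- by move=> x; rewrite -[f x - h x](subrKA (g x)); exact: ler_normD.
Qed.

Lemma Lnorm_patch_le f g (A : set (Rn R d)) : measurable A ->
  bochner_measurable leb f -> bochner_measurable leb g ->
  (forall x, A x -> `|f x| <= `|g x|) ->
  (N (patch (fun=> 0%R) A f) <= N g)%E.
Proof.
move=> mA mf mg fg.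
have m1 := bochner_measurable_normr cmu (bochner_measurable_patch mA mf).
have m2 := bochner_measurable_normr cmu mg.
apply: (@le_bochner_Lnorm _ (Rn R d) R leb p p1 B B _ _ m1 m2).
move=> x; rewrite patch0E; case: ifPn => [|_]; last by rewrite normr0.
by rewrite inE => /fg.
Qed.

Lemma Lnorm_translateB h f g : bochner_measurable leb f ->
  bochner_measurable leb g ->
  N (fun x => translate h f x - translate h g x)%R = N (fun x => f x - g x)%R.
Proof.
move=> mf mg.
exact: (Lnorm_translate p h (bochner_measurableB mf mg)).
Qed.

(** Translations are isometries, so that the modulus of continuity of f is
    controlled by that of any function near f. *)
Lemma Lnorm_modulus_le h f g : bochner_measurable leb f ->
  bochner_measurable leb g ->
  (N (fun x => translate h f x - f x)%R <=
   N (fun x => translate h g x - g x)%R + (N (fun x => f x - g x)%R +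
   N (fun x => f x - g x)%R))%E.
Proof.
move=> mf mg.
have mhf := bochner_measurable_translate h mf.
have mhg := bochner_measurable_translate h mg.
apply: le_trans (Lnorm_dist_triangle mhf mhg mf) _.
rewrite Lnorm_translateB// addeCA leeD2l// (Lnorm_sym f g).
exact: Lnorm_dist_triangle.
Qed.

Lemma integral_powR_patch (A : set (Rn R d)) f :
  (\int[leb]_(x in A) (`|f x| `^ p)%:E =
   \int[leb]_x (`|patch (fun=> 0%R) A f x| `^ p)%:E)%E.
Proof.
rewrite integral_mkcond; apply: eq_integral => x _.
rewrite patch0E /restrict /patch; case: ifP => // _.
by rewrite normr0 powR0// gt_eqF.
Qed.

Section totally_bounded_necessary.
Variable F : set (Lp leb B p).
Hypothesis tbF : totally_bounded (@Lp_dist _ _ _ leb B p) F.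

(** One member of each piece of a finite cover is replaced by a step function;
    for step functions the first two conditions are elementary. *)
Lemma totally_bounded_grid_steps (e : R) : 0 < e ->
  exists G : set (Rn R d -> B), [/\ finite_set G,
    (forall g, G g -> exists n L, grid_step n L g) &
    forall f : Lp leb B p, F f ->
      exists2 g, G g & (N (fun x => f x - g x)%R < e%:E)%E].
Proof.
move=> e0; have e2 : 0 < e / 2 by rewrite divr_gt0.
have [C [fC CP FC]] := tbF e2.
have /choice[G GP] (U : set (Lp leb B p)) : exists g : Rn R d -> B,
    (exists n L, grid_step n L g) /\
    ((exists f : Lp leb B p, U f) -> exists2 f : Lp leb B p, U f &
      (N (fun x => f x - g x)%R < (e / 2)%:E)%E).
  have [[f Uf]|nU] := pselect (exists f : Lp leb B p, U f).
    have [g sg fg] :=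
      grid_step_dense p1 (Lp_fun_measurable f) (Lp_fun_finite f) e2.
    by exists g; split => // _; exists f.
  exists (fun=> 0); split => //.
  by exists 1%N, 0%N; split => //; exists (fun=> 0).
exists (G @` C); split.
- exact: finite_image.
- by move=> _ [U CU <-]; have [] := GP U.
- move=> f Ff; have [U CU Uf] := FC _ Ff; exists (G U); first by exists U.
  have [sg [|f' Uf' f'g]] := GP U; first by exists f.
  have mg : bochner_measurable leb (G U).
    by have [n [L /grid_step_measurable]] := sg.
  apply: le_lt_trans (Lnorm_dist_triangle (Lp_fun_measurable f)
    (Lp_fun_measurable f') mg) _.
  rewrite (splitr e) EFinD lteD//.
  apply: le_lt_trans (CP _ CU).
  exact: (@dist_le_diameter _ _ (@Lp_dist _ _ _ leb B p)).
Qed.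

Lemma totally_bounded_equivanishing : Lp_equivanishing F.
Proof.
move=> e e0.
have e'0 : 0 < e `^ p^-1 by rewrite powR_gt0.
have [G [fG GP FG]] := totally_bounded_grid_steps e'0.
have [L _ GL] : \forall L \near \oo, forall g, G g ->
    forall x, ~ half_open_cube L x -> g x = 0.
  apply: finite_eventually => // g /GP[n [L sg]].
  exists L => // M /= LM; have [_ _ gM] := grid_step_widen LM sg; exact: gM.
near=> r => f Ff.
have [g Gg fg] := FG _ Ff.
have mA := @measurable_enorm_gt R d r.
have [n [L' sg]] := GP _ Gg; have mg := grid_step_measurable sg.
have mf := Lp_fun_measurable f.
rewrite integral_powR_patch.
have -> : e = (e `^ p^-1) `^ p by rewrite -powRrM mulVf ?gt_eqF// powRr1// ltW.
rewrite -bochner_Lnorm_lt//; last exact: ltW.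
apply: le_lt_trans fg; apply: Lnorm_patch_le => //.
  exact: bochner_measurableB.
move=> x /= rx; rewrite (GL L (leqnn L) g Gg) ?subr0//.
move=> /enorm_half_open_cube xr.
have : Num.sqrt (d%:R * L%:R ^+ 2) <= r by near: r; exact: nbhs_pinfty_ge.
by move=> /(le_trans xr); rewrite leNgt rx.
Unshelve. all: by end_near. Qed.

Lemma totally_bounded_equicontinuous : Lp_equicontinuous F.
Proof.
move=> e e0; have e3 : 0 < e / 3 by rewrite divr_gt0.
have [G [fG GP FG]] := totally_bounded_grid_steps e3.
have [k _ Gk] : \forall k \near \oo, forall g, G g -> forall h : Rn R d,
    (forall i, `|h ord0 i| <= k.+1%:R^-1) ->
    (N (fun x => translate h g x - g x)%R < (e / 3)%:E)%E.
  apply: finite_eventually => // g /GP[n [L sg]].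
  have [delta delta0 dg] := grid_step_translate p1 sg e3.
  apply: filterS (near_infty_natSinv_lt (PosNum delta0)) => k /= kd h hk.
  by apply: dg => i; rewrite (le_trans (hk i))// ltW.
exists k.+1%:R^-1; first by rewrite invr_gt0.
move=> h hk f Ff; have [g Gg fg] := FG _ Ff.
have [n [L sg]] := GP _ Gg; have mg := grid_step_measurable sg.
have hg : (N (fun x => translate h g x - g x)%R < (e / 3)%:E)%E.
  apply: (Gk k) => //= i; exact: le_trans (coord_le_enorm h i) (ltW hk).
apply: le_lt_trans (Lnorm_modulus_le h (Lp_fun_measurable f) mg) _.
have -> : (e%:E = (e / 3)%:E + ((e / 3)%:E + (e / 3)%:E))%E.
  by rewrite -!EFinD; congr EFin; lra.
by rewrite lteD// lteD.
Qed.

Lemma totally_bounded_mean : totally_bounded_in_mean F.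
Proof.
move=> E mE [M EM] e e0; have e2 : 0 < e / 2 by rewrite divr_gt0.
have Eoo : (leb E < +oo)%E.
  apply: le_lt_trans (lebesgueRn_half_open_cube_lty R d (Num.trunc M).+1).
  apply: lebesgueRn_le => x /EM xM; apply: half_open_cube_enorm.
  by apply: le_lt_trans xM _; exact: truncnS_gt.
have [delta delta0 dP] := integral_patch_small B cmu p1 mE Eoo e2.
have [C [fC CP FC]] := tbF delta0.
exists [set [set bochner_integral leb E f | f in U] | U in C]; split.
- exact: finite_image.
- move=> _ [U CU <-]; apply: (@le_lt_trans _ _ (e / 2)%:E); last first.
    by rewrite lte_fin ltr_pdivrMr// ltr_pMr// ltr1n.
  apply: diameter_le => _ _ [f Uf <-] [g Ug <-].
  have mf := Lp_fun_measurable f; have mg := Lp_fun_measurable g.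
  apply: le_trans (bochner_integral_dist cmu mE mf mg _ _) _.
  + exact: (integral_patch_lty cmu p1 mE Eoo mf (Lp_fun_finite f)).
  + exact: (integral_patch_lty cmu p1 mE Eoo mg (Lp_fun_finite g)).
  apply: ltW; apply: dP; first exact: bochner_measurableB.
  apply: le_lt_trans (CP _ CU).
  exact: (@dist_le_diameter _ _ (@Lp_dist _ _ _ leb B p)).
- move=> _ [f Ff <-]; have [U CU Uf] := FC _ Ff.
  by exists [set bochner_integral leb E f | f in U]; [exists U|exists f].
Qed.

End totally_bounded_necessary.

End kolmogorov_riesz_directions.

(** * Sufficiency *)

Section kolmogorov_riesz_sufficient.
Variables (R : realType) (d : nat) (B : completeNormedModType R).
Variable p : R.
Hypothesis p1 : 1 <= p.
Let p_gt0 : 0 < p. Proof. exact: lt_le_trans p1. Qed.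
Local Notation leb := (@lebesgueRn R d).
Local Notation N := (bochner_Lnorm leb p).
Implicit Types (f g : Rn R d -> B).

Let cmu := @lebesgueRn_complete R d.

(** The difference of two averages takes one value on each of the finitely many
    cells of the cube, so that a uniform bound on these values suffices. *)
Lemma cell_average_close n L (s : R) : (0 < n)%N -> 0 < s ->
  exists2 eta : R, 0 < eta & forall f g,
    (forall z : 'rV[int]_d, index_cube (n * L) z ->
      `|bochner_integral leb (grid_cell n z) f -
        bochner_integral leb (grid_cell n z) g| <= eta) ->
    (N (fun x => cell_average n L f x - cell_average n L g x)%R < s%:E)%E.
Proof.
move=> n0 s0.
have [eta eta0 etaP] := bochner_Lnorm_small p1
  (@measurable_half_open_cube R d L) (lebesgueRn_half_open_cube_lty R d L) s0.
have nd0 : 0 < n%:R ^+ d :> R by rewrite exprn_gt0// ltr0n.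
exists (eta / n%:R ^+ d); first by rewrite divr_gt0.
move=> f g fg; apply: etaP.
  apply: bochner_measurable_normrB.
    exact: grid_step_measurable (grid_step_cell_average L f n0).
  exact: grid_step_measurable (grid_step_cell_average L g n0).
move=> x; rewrite /cell_average !patch0E indicE; case: ifPn => xK; last first.
  by rewrite subrr normr0 mulr0.
rewrite mulr1 -scalerBr normrZ (gtr0_norm nd0) mulrC -ler_pdivlMr//.
by apply: fg; move: xK; rewrite inE (@half_open_cubeE R d n).
Qed.

(** The estimate behind sufficiency. It holds for step functions by the
    discrete averaging bound, and passes to the limit because both sides are
    continuous for the norm of order p at a fixed scale n. *)
Lemma cell_average_approx n L (s : R) f : (0 < n)%N -> 0 < s ->
  bochner_measurable leb f -> (N f < +oo)%E ->
  (forall h : Rn R d, (forall i, `|h ord0 i| <= n%:R^-1) ->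
    (N (fun x => translate h f x - f x)%R <= s%:E)%E) ->
  (N (patch (fun=> 0%R) (~` half_open_cube L) f) <= s%:E)%E ->
  (N (fun x => f x - cell_average n L f x)%R <=
   ((3 ^+ d * 3 + 3) * s)%:E)%E.
Proof.
move=> n0 s0 mf foo fs ftail.
pose K := @half_open_cube R d L.
have mK : measurable K by exact: measurable_half_open_cube.
have Koo : (leb K < +oo)%E by exact: lebesgueRn_half_open_cube_lty.
have [eta eta0 etaP] := cell_average_close L n0 s0.
have [delta delta0 dP] := integral_patch_small B cmu p1 mK Koo eta0.
have e0 : 0 < Num.min s delta by rewrite lt_min s0.
have [g [m [M sgm]] fg'] := grid_step_dense p1 mf foo e0.
have m0 : (0 < m)%N by case: sgm.
have sg : grid_step (n * m) M g by rewrite mulnC; exact: grid_step_refine.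
have mg := grid_step_measurable sg.
have fgs : (N (fun x => f x - g x)%R <= s%:E)%E.
  by apply: le_trans (ltW fg') _; rewrite lee_fin ge_min lexx.
have fgd : (N (fun x => f x - g x)%R < delta%:E)%E.
  by apply: lt_le_trans fg' _; rewrite lee_fin ge_min lexx orbT.
have msf := grid_step_measurable (grid_step_cell_average L f n0).
have msg := grid_step_measurable (grid_step_cell_average L g n0).
have goo : (N g < +oo)%E.
  apply: (@le_lt_trans _ _ (N f + N (fun x => f x - g x)%R)%E).
    apply: (Rn_Lnorm_triangle p1) => //; first exact: bochner_measurableB.
    move=> x; rewrite -{1}(subKr (f x) (g x)) (le_trans (ler_normB _ _))//.
  by rewrite lte_add_pinfty// (lt_trans fgd)// ltry.
have close :
    (N (fun x => cell_average n L g x - cell_average n L f x)%R < s%:E)%E.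
  apply: etaP => z Kz; rewrite -lee_fin.
  have cK : grid_cell n z `<=` K.
    by move=> x xz; rewrite /K (@half_open_cubeE R d n)//= xz.
  have mz : measurable (grid_cell n z : set (Rn R d)) by exact: measurable_grid.
  have zoo : (leb (grid_cell n z) < +oo)%E.
    by apply: le_lt_trans Koo; exact: lebesgueRn_le.
  rewrite distrC.
  apply: le_trans (bochner_integral_dist cmu mz mf mg _ _) _.
  - exact: (integral_patch_lty cmu p1 mz zoo mf foo).
  - exact: (integral_patch_lty cmu p1 mz zoo mg goo).
  have mfg := bochner_measurableB mf mg.
  apply: le_trans (ltW (dP _ mfg fgd)).
  apply: ge0_le_integral.
  - exact: measurableT.
  - by move=> x _; rewrite lee_fin.
  - apply/measurable_EFinP; apply: (bochner_measurable_normr cmu).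
    exact: bochner_measurable_patch.
  - apply/measurable_EFinP; apply: (bochner_measurable_normr cmu).
    exact: bochner_measurable_patch.
  - move=> x _; rewrite lee_fin !patch0E; case: ifPn => [xz|_]; last first.
      by rewrite normr0.
    by rewrite mem_set//; apply: cK; rewrite inE in xz.
have g3 (h : Rn R d) : (forall i, `|h ord0 i| <= n%:R^-1) ->
    (N (fun x => translate h g x - g x)%R <= (3 * s)%:E)%E.
  move=> hn; apply: le_trans (Lnorm_modulus_le p1 h mg mf) _.
  rewrite (Lnorm_sym p g f) (_ : 3 * s = s + (s + s)); last by lra.
  by rewrite !EFinD leeD// ?leeD//; exact: fs.
have s30 : 0 <= 3 * s by rewrite mulr_ge0// ltW.
have gPg := cell_average_dist L p1 s30 n0 m0 sg g3.
have mKf := bochner_measurable_patch mK mf.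
have mKg := bochner_measurable_patch mK mg.
have t1 : (N (fun x => f x - patch (fun=> 0) K f x)%R <= s%:E)%E.
  apply: le_trans ftail; rewrite le_eqVlt; apply/orP; left; apply/eqP.
  apply: eq_bochner_Lnorm => x; rewrite !patch0E in_setC.
  by case: (x \in K); rewrite /= ?subrr ?subr0.
have t2 :
    (N (fun x => patch (fun=> 0) K f x - patch (fun=> 0) K g x)%R <= s%:E)%E.
  apply: le_trans fgs.
  have -> : N (fun x => patch (fun=> 0) K f x - patch (fun=> 0) K g x)%R =
            N (patch (fun=> 0%R) K (fun x => f x - g x)%R).
    apply: eq_bochner_Lnorm => x; rewrite !patch0E.
    by case: (x \in K); rewrite ?subrr.
  by apply: (Lnorm_patch_le p1) => //; exact: bochner_measurableB.
apply: le_trans (Lnorm_dist_triangle p1 mf mKf msf) _.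
have -> : (3 ^+ d * 3 + 3) * s = s + (s + (3 ^+ d * (3 * s) + s)) by ring.
rewrite EFinD leeD// EFinD.
apply: le_trans (Lnorm_dist_triangle p1 mKf mKg msf) _.
rewrite leeD// EFinD.
apply: le_trans (Lnorm_dist_triangle p1 mKg msg msf) _.
by rewrite leeD// ltW.
Qed.

(** The averages live on finitely many cells, hence are determined by finitely
    many vectors in totally bounded sets, and all members of F are uniformly
    close to their averages. *)
Lemma kolmogorov_riesz_sufficient (F : set (Lp leb B p)) :
  Lp_equivanishing F -> Lp_equicontinuous F -> totally_bounded_in_mean F ->
  totally_bounded (@Lp_dist _ _ _ leb B p) F.
Proof.
move=> vanF contF meanF e e0.
(* Two functions of one piece are each within c * s of their averages, which
   differ by at most s; this s makes the total at most e / 2. *)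
pose c : R := 3 ^+ d * 3 + 3; pose s := e / (4 * (c + 1)).
have c0 : 0 < c by rewrite ltr_wpDl// mulr_ge0// exprn_ge0.
have s0 : 0 < s by rewrite divr_gt0// mulr_gt0// addr_gt0.
have sE : c * s + (s + c * s) <= e / 2.
  have -> : e / 2 = 2 * (c + 1) * s.
    by rewrite /s; field; rewrite gt_eqF// addr_gt0.
  by lra.
have [r [_ rP]] := vanF (s `^ p) (powR_gt0 p s0).
pose L := (Num.trunc (r + 1)).+1.
have tail (f : Lp leb B p) : F f ->
    (N (patch (fun=> 0%R) (~` half_open_cube L) f) <= s%:E)%E.
  move=> Ff; have mf := Lp_fun_measurable f.
  have mA := @measurable_enorm_gt R d (r + 1).
  have mK : measurable (~` @half_open_cube R d L).
    by apply: measurableC; exact: measurable_half_open_cube.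
  have /rP/(_ f Ff) : r < r + 1 by rewrite ltrDl.
  rewrite (integral_powR_patch p1) -bochner_Lnorm_lt//; last exact: ltW.
  move=> /ltW; apply: le_trans.
  apply: (Lnorm_patch_le p1) => //; first exact: bochner_measurable_patch.
  move=> x Kx; rewrite patch0E mem_set//= ltNge; apply/negP => xr; apply: Kx.
  by apply: half_open_cube_enorm; apply: le_lt_trans xr _; exact: truncnS_gt.
have [delta delta0 dP] := contF _ s0.
have [n n0 nP] := @enorm_small R d _ delta0.
have approx (f : Lp leb B p) : F f ->
    (N (fun x => f x - cell_average n L f x)%R <= (c * s)%:E)%E.
  move=> Ff; apply: cell_average_approx => //.
  - exact: Lp_fun_measurable.
  - exact: Lp_fun_finite.
  - by move=> h /nP hd; apply: ltW; exact: dP.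
  - exact: tail.
have [eta eta0 etaP] := cell_average_close L n0 s0.
have [|C [fC FC CP]] := @totally_bounded_common_cover R B _ F _
  (index_cube (n * L))
  (fun z (f : Lp leb B p) => bochner_integral leb (grid_cell n z) f) eta
  (finite_index_cube d (n * L)) eta0.
  move=> z Kz; apply: meanF; first exact: measurable_grid.
  exists (Num.sqrt (d%:R * L%:R ^+ 2)) => x xz; apply: enorm_half_open_cube.
  by rewrite (@half_open_cubeE R d n)//= xz.
exists C; split => // U CU; have [UF UP] := CP _ CU.
apply: (@le_lt_trans _ _ (e / 2)%:E); last first.
  by rewrite lte_fin ltr_pdivrMr// ltr_pMr// ltr1n.
apply: diameter_le => f g Uf Ug; have Ff := UF _ Uf; have Fg := UF _ Ug.
have mf := Lp_fun_measurable f; have mg := Lp_fun_measurable g.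
have msf := grid_step_measurable (grid_step_cell_average L f n0).
have msg := grid_step_measurable (grid_step_cell_average L g n0).
apply: le_trans (Lnorm_dist_triangle p1 mf msf mg) _.
apply: (@le_trans _ _ ((c * s)%:E + (s%:E + (c * s)%:E))%E); last first.
  by rewrite -!EFinD lee_fin.
apply: leeD; first exact: approx.
apply: le_trans (Lnorm_dist_triangle p1 msf msg mg) _.
apply: leeD; last by rewrite Lnorm_sym; exact: approx.
by apply: ltW; apply: etaP => z Kz; apply: ltW; exact: UP.
Qed.

End kolmogorov_riesz_sufficient.

Theorem theorem2p4 (R : realType) (d : nat) (B : completeNormedModType R)
    (p : R) (hp : 1 <= p) (F : set (Lp (@lebesgueRn R d) B p)) :
  totally_bounded (@Lp_dist _ _ _ (@lebesgueRn R d) B p) F <->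
  [/\ Lp_equivanishing F, Lp_equicontinuous F & totally_bounded_in_mean F].
Proof.
split => [tbF|[vanF contF meanF]]; last exact: kolmogorov_riesz_sufficient.
split.
- exact: totally_bounded_equivanishing.
- exact: totally_bounded_equicontinuous.
- exact: totally_bounded_mean.
Qed.
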